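(* Let $R$ be a commutative ring with identity and let $x$ be an indeterminate over $R$. If the power series ring $R[[x]]$ is a coherent ring, then $\mathrm{Gwdim}(R[[x]])=\mathrm{Gwdim}(R)+1$ (both sides are allowed to be $\infty$).
   Context: All rings are commutative with identity and all modules are unital. A ring is coherent if every finitely generated ideal is finitely presented. An $R$-module $M$ is Gorenstein flat if there is an exact complex of flat $R$-modules $\cdots\to F_1\to F_0\to F^0\to F^1\to\cdots$ with $M\cong \mathrm{Im}(F_0\to F^0)$ that remains exact after applying $-\otimes_R I$ for every injective $R$-module $I$. The Gorenstein flat dimension $\mathrm{Gfd}_R(M)\in\{0,1,2,\dots\}\cup\{\infty\}$ of a module $M$ is the least $n$ such that there is an exact sequence $0\to G_n\to\cdots\to G_0\to M\to 0$ with all $G_i$ Gorenstein flat ($\infty$ if there is none). The Gorenstein weak dimension of $R$ is $\mathrm{Gwdim}(R)=\sup\{\mathrm{Gfd}_R(M)\mid M \text{ an } R\text{-module}\}$. *)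

(* Defs.v *)
From HB Require Import structures.
From mathcomp Require Import all_boot all_order all_algebra.
From mathcomp Require Import boolp.
From mathcomp.multinomials Require Import freeg.

Set Implicit Arguments.
Unset Strict Implicit.
Unset Printing Implicit Defensive.

Import GRing.Theory.
Local Open Scope ring_scope.
Local Open Scope quotient_scope.

Section PowerSeries.
Variable R : comNzRingType.

(* R[[x]], with pscoef a n the coefficient of x^n in a.  A record rather than an
   alias of nat -> R, which carries a pointwise ring structure in other
   libraries. *)
Record powerSeries : Type := PowerSeries { pscoef : nat -> R }.

HB.instance Definition _ := gen_eqMixin powerSeries.
HB.instance Definition _ := gen_choiceMixin powerSeries.

Implicit Types a b c : powerSeries.

Lemma powerSeriesP a b : (forall n, pscoef a n = pscoef b n) -> a = b.
Proof. by case: a b => [a] [b] /= ab; congr PowerSeries; apply/funext. Qed.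

Definition ps0 := PowerSeries (fun _ => 0).
Definition psopp a := PowerSeries (fun n => - pscoef a n).
Definition psadd a b := PowerSeries (fun n => pscoef a n + pscoef b n).
Definition ps1 := PowerSeries (fun n => (n == 0%N)%:R).
Definition psmul a b :=
  PowerSeries (fun n => \sum_(i < n.+1) pscoef a i * pscoef b (n - i)).

Fact psaddA : associative psadd.
Proof. by move=> a b c; apply: powerSeriesP => n /=; rewrite addrA. Qed.
Fact psaddC : commutative psadd.
Proof. by move=> a b; apply: powerSeriesP => n /=; rewrite addrC. Qed.
Fact psadd0 : left_id ps0 psadd.
Proof. by move=> a; apply: powerSeriesP => n /=; rewrite add0r. Qed.
Fact psaddN : left_inverse ps0 psopp psadd.
Proof. by move=> a; apply: powerSeriesP => n /=; rewrite addNr. Qed.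
HB.instance Definition _ :=
  GRing.isZmodule.Build powerSeries psaddA psaddC psadd0 psaddN.

Definition pstrunc n a : {poly R} := \poly_(i < n.+1) pscoef a i.

Fact pscoef_mul n k a b :
  (k <= n)%N -> pscoef (psmul a b) k = (pstrunc n a * pstrunc n b)`_k.
Proof.
move=> kn; rewrite coefM; apply: eq_bigr => i _.
by rewrite !coef_poly !ltnS (leq_trans (leq_subr _ _) kn)
  (leq_trans _ kn) // -ltnS ltn_ord.
Qed.

Fact psmulA : associative psmul.
Proof.
move=> a b c; apply: powerSeriesP => n.
transitivity (pstrunc n a * (pstrunc n b * pstrunc n c))`_n.
  rewrite coefM; apply: eq_bigr => i _.
  by rewrite coef_poly ltn_ord (@pscoef_mul n) ?leq_subr.
rewrite mulrA coefM; apply: eq_bigr => i _.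
by rewrite coef_poly ltnS leq_subr (@pscoef_mul n) // -ltnS ltn_ord.
Qed.

Fact psmulC : commutative psmul.
Proof.
by move=> a b; apply: powerSeriesP => n; rewrite !(@pscoef_mul n) // mulrC.
Qed.

Fact psmul1 : left_id ps1 psmul.
Proof.
move=> a; apply: powerSeriesP => n /=.
by rewrite big_ord_recl /= mul1r subn0 big1 ?addr0 // => i _; rewrite mul0r.
Qed.

Fact psmulDl : left_distributive psmul psadd.
Proof.
move=> a b c; apply: powerSeriesP => n /=.
by rewrite -big_split; apply: eq_bigr => i _; rewrite mulrDl.
Qed.

Fact ps1_neq0 : ps1 != ps0 :> powerSeries.
Proof.
by apply/eqP => /(congr1 (pscoef ^~ 0%N)) /= /eqP; rewrite oner_eq0.
Qed.

HB.instance Definition _ := GRing.Zmodule_isComNzRing.Build powerSeries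
  psmulA psmulC psmul1 psmulDl ps1_neq0.

End PowerSeries.

Section Submodule.
Variables (R : comNzRingType) (M : lmodType R) (S : submodClosed M).

Record submod : Type := Submod { submod_val :> M; _ : submod_val \in S }.

HB.instance Definition _ := [isSub for submod_val].
HB.instance Definition _ := [Choice of submod by <:].
HB.instance Definition _ := [SubChoice_isSubLmodule of submod by <:].

End Submodule.

Section QuotientModule.
Variables (R : comNzRingType) (M : lmodType R) (S : submodClosed M).

(* SubmodClosed, stated for semimodules, does not provide the ZmodClosed
   instance that quotients require. *)
Definition subzmod (x : M) : bool := x \in S.

Fact subzmod_closed : zmod_closed subzmod.
Proof. exact: GRing.submod_closedB (submodClosedP S). Qed.
HB.instance Definition _ := GRing.isZmodClosed.Build M subzmod subzmod_closed.

Definition subzmodC : zmodClosed M := GRing.ZmodClosed.clone M subzmod _.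

Definition quotmod : Type := Quotient.quot subzmodC.
HB.instance Definition _ := GRing.Zmodule.on quotmod.

Definition qpi (x : M) : quotmod := \pi_(Quotient.quot subzmodC) x.
Definition qrepr (x : quotmod) : M := repr (x : Quotient.quot subzmodC).

Lemma qreprK x : qpi (qrepr x) = x. Proof. exact: reprK. Qed.

Lemma qpi_eq x y : qpi x = qpi y <-> x - y \in S.
Proof.
have xyE := Quotient.idealrBE subzmodC x y.
by split=> [/eqP|xy]; [rewrite -xyE|apply/eqP; rewrite -xyE].
Qed.

Lemma qpiD x y : qpi (x + y) = qpi x + qpi y.
Proof. by rewrite /qpi !piE. Qed.

Definition qscale a (x : quotmod) := qpi (a *: qrepr x).

Lemma qpiZ a x : qpi (a *: x) = qscale a (qpi x).
Proof.
by apply/qpi_eq; rewrite -scalerBr rpredZ //; apply/qpi_eq; rewrite qreprK.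
Qed.

Fact qscaleA a b x : qscale a (qscale b x) = qscale (a * b) x.
Proof. by rewrite -(qreprK x) -!qpiZ scalerA. Qed.
Fact qscale1 : left_id 1 qscale.
Proof. by move=> x; rewrite /qscale scale1r qreprK. Qed.
Fact qscaleDr : right_distributive qscale +%R.
Proof.
move=> a x y.
by rewrite -(qreprK x) -(qreprK y) -qpiD -!qpiZ scalerDr qpiD.
Qed.
Fact qscaleDl x : {morph qscale^~ x : a b / a + b}.
Proof. by move=> a b; rewrite -(qreprK x) -!qpiZ scalerDl qpiD. Qed.

HB.instance Definition _ := GRing.Zmodule_isLmodule.Build R quotmod
  qscaleA qscale1 qscaleDr qscaleDl.

Fact qpi_is_linear : linear qpi.
Proof. by move=> a x y; rewrite qpiD qpiZ. Qed.
HB.instance Definition _ := GRing.isLinear.Build R M quotmod _ qpi qpi_is_linear.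

End QuotientModule.

Arguments qpi {R M} S x.

Section FreeLift.
Variables (R : comNzRingType) (K : choiceType) (M : lmodType R) (f : K -> M).

Fact fglift_is_linear : linear (fglift f : {freeg K / R} -> M).
Proof.
have liftB := lift_is_additive f.
have lift0 : fglift f 0 = 0 by have := liftB 0 0; rewrite !subrr.
have liftD x y : fglift f (x + y) = fglift f x + fglift f y.
  have liftN z : fglift f (- z) = - fglift f z.
    by have := liftB 0 z; rewrite !sub0r lift0 sub0r.
  by have := liftB x (- y); rewrite opprK liftN opprK.
have liftS (s : seq K) (F : K -> {freeg K / R}) :
    fglift f (\sum_(x <- s) F x) = \sum_(x <- s) fglift f (F x).
  by elim: s => [|x s ih]; rewrite ?big_nil // !big_cons liftD ih.
move=> a x y; rewrite liftD; congr (_ + _).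
rewrite -[in LHS](freeg_sumE x) -[in RHS](freeg_sumE x) scaler_sumr !liftS.
rewrite scaler_sumr; apply: eq_bigr => z _.
rewrite liftU.
have -> : a *: << coeff z x *g z >> = << a * coeff z x *g z >>.
  by apply/eqP/freeg_eqP => t; rewrite coeffZ !coeffU mulrA.
by rewrite liftU scalerA.
Qed.

End FreeLift.

Section Tensor.
Variables (R : comNzRingType) (M N : lmodType R).

(* The submodule of the free module on M * N generated by the bilinearity
   relations. *)
Inductive tensor_rel : {freeg (M * N)%type / R} -> Prop :=
| tensor_rel0 : tensor_rel 0
| tensor_relP a u v : tensor_rel u -> tensor_rel v -> tensor_rel (a *: u + v)
| tensor_relDl m m' n :
    tensor_rel (<< (m + m', n) >> - << (m, n) >> - << (m', n) >>)
| tensor_relDr m n n' :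
    tensor_rel (<< (m, n + n') >> - << (m, n) >> - << (m, n') >>)
| tensor_relZl a m n : tensor_rel (<< (a *: m, n) >> - a *: << (m, n) >>)
| tensor_relZr a m n : tensor_rel (<< (m, a *: n) >> - a *: << (m, n) >>).

Definition tensor_relb (u : {freeg (M * N)%type / R}) : bool := `[< tensor_rel u >].

Fact tensor_rel_submod : submod_closed tensor_relb.
Proof.
split; first exact/asboolP/tensor_rel0.
by move=> a u v /asboolP hu /asboolP hv; apply/asboolP/tensor_relP.
Qed.

HB.instance Definition _ :=
  GRing.isSubmodClosed.Build R {freeg (M * N)%type / R} tensor_relb
    tensor_rel_submod.

Definition tensor_sub : submodClosed {freeg (M * N)%type / R} :=
  GRing.SubmodClosed.clone R {freeg (M * N)%type / R} tensor_relb _.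

Definition tensor : Type := quotmod tensor_sub.
HB.instance Definition _ := GRing.Lmodule.on tensor.

Definition tens (m : M) (n : N) : tensor := qpi tensor_sub << (m, n) >>.

Lemma tensDl m m' n : tens (m + m') n = tens m n + tens m' n.
Proof.
rewrite /tens -qpiD; apply/qpi_eq; rewrite opprD addrA.
exact/asboolP/tensor_relDl.
Qed.

Lemma tensDr m n n' : tens m (n + n') = tens m n + tens m n'.
Proof.
rewrite /tens -qpiD; apply/qpi_eq; rewrite opprD addrA.
exact/asboolP/tensor_relDr.
Qed.

Lemma tensZl a m n : tens (a *: m) n = a *: tens m n.
Proof. by rewrite /tens -linearZ; apply/qpi_eq/asboolP/tensor_relZl. Qed.

Lemma tensZr a m n : tens m (a *: n) = a *: tens m n.
Proof. by rewrite /tens -linearZ; apply/qpi_eq/asboolP/tensor_relZr. Qed.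

End Tensor.

Section TensorMap.
Variables (R : comNzRingType) (N A B : lmodType R) (f : {linear A -> B}).

Definition tensor_lift (u : {freeg (A * N)%type / R}) : tensor B N :=
  fglift (fun an => tens (f an.1) an.2) u.

Fact tensor_lift_is_linear : linear tensor_lift.
Proof. exact: fglift_is_linear. Qed.
HB.instance Definition _ := GRing.isLinear.Build R {freeg (A * N)%type / R}
  (tensor B N) _ tensor_lift tensor_lift_is_linear.

Lemma tensor_liftU a n : tensor_lift << (a, n) >> = tens (f a) n.
Proof. by rewrite /tensor_lift liftU scale1r. Qed.

Lemma tensor_lift_rel u : tensor_rel u -> tensor_lift u = 0.
Proof.
elim=> [|a v w _ vE _ wE|m m' n|m n n'|a m n|a m n].
- exact: linear0.
- by rewrite linearP /= vE wE scaler0 addr0.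
- by rewrite !linearB /= !tensor_liftU linearD tensDl addrAC addrK subrr.
- by rewrite !linearB /= !tensor_liftU tensDr addrAC addrK subrr.
- by rewrite linearB linearZ /= !tensor_liftU linearZ tensZl subrr.
- by rewrite linearB linearZ /= !tensor_liftU tensZr subrr.
Qed.

(* Independent of the chosen representative by tensor_map_pi. *)
Definition tensor_map (t : tensor A N) : tensor B N := tensor_lift (qrepr t).

Lemma tensor_map_pi u : tensor_map (qpi (tensor_sub A N) u) = tensor_lift u.
Proof.
apply/eqP; rewrite -subr_eq0 -linearB; apply/eqP/tensor_lift_rel/asboolP.
by apply: (qpi_eq (tensor_sub A N) _ _).1; rewrite qreprK.
Qed.

Lemma tensor_mapE a n : tensor_map (tens a n) = tens (f a) n.
Proof. by rewrite tensor_map_pi tensor_liftU. Qed.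

Fact tensor_map_is_linear : linear tensor_map.
Proof.
move=> a x y; rewrite -(qreprK x) -(qreprK y) -linearP !tensor_map_pi.
exact: linearP.
Qed.
HB.instance Definition _ := GRing.isLinear.Build R (tensor A N) (tensor B N) _
  tensor_map tensor_map_is_linear.

End TensorMap.

Arguments tensor_map {R} N {A B} f t.

Section Modules.
Variable R : comNzRingType.

Definition exact_at (A B C : lmodType R) (f : A -> B) (g : B -> C) : Prop :=
  forall y, g y = 0 <-> exists x, f x = y.

Definition flat (M : lmodType R) : Prop :=
  forall (A B C : lmodType R) (f : {linear A -> B}) (g : {linear B -> C}),
    exact_at f g -> exact_at (tensor_map M f) (tensor_map M g).

Definition injective_module (I : lmodType R) : Prop :=
  forall (A B : lmodType R) (i : {linear A -> B}) (f : {linear A -> I}),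
    injective i -> exists g : {linear B -> I}, forall x, g (i x) = f x.

(* The complex is ... -> F 1 -> F 0 -> F (-1) -> ..., with d 0 playing the role
   of F_0 -> F^0; j is an isomorphism of M onto the image of d 0. *)
Definition gorenstein_flat (M : lmodType R) : Prop :=
  exists (F : int -> lmodType R) (d : forall i, {linear F i -> F (i - 1)})
         (j : {linear M -> F (0 - 1)}),
    [/\ forall i, flat (F i),
        forall i, exact_at (d i) (d (i - 1)),
        forall I : lmodType R, injective_module I -> forall i,
          exact_at (tensor_map I (d i)) (tensor_map I (d (i - 1))),
        injective j
      & forall y, (exists m, j m = y) <-> (exists x, d 0 x = y)].

(* 0 -> G n -> ... -> G 0 -> M -> 0, continued by zero beyond G n. *)
Definition gorenstein_flat_resolution (M : lmodType R) (n : nat) : Prop :=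
  exists (G : nat -> lmodType R) (g : forall i, {linear G i.+1 -> G i})
         (e : {linear G 0%N -> M}),
    [/\ forall i, (i <= n)%N -> gorenstein_flat (G i),
        forall i, (n < i)%N -> forall x : G i, x = 0,
        forall y, exists x, e x = y,
        exact_at (g 0%N) e
      & forall i, exact_at (g i.+1) (g i)].

Definition finitely_generated (M : lmodType R) : Prop :=
  exists (n : nat) (v : 'I_n -> M),
    forall x, exists c : 'I_n -> R, x = \sum_(i < n) c i *: v i.

Definition finitely_presented (M : lmodType R) : Prop :=
  exists (m n : nat) (f : {linear 'rV[R]_m -> 'rV[R]_n})
         (p : {linear 'rV[R]_n -> M}),
    exact_at f p /\ forall y, exists x, p x = y.

Definition coherent : Prop :=
  forall I : submodClosed R^o,
    finitely_generated (submod I) -> finitely_presented (submod I).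

End Modules.

(* Elements of {0, 1, 2, ...} U {oo}, with None for oo. *)
Definition enat := option nat.

Definition enat_le (a b : enat) : bool :=
  match a, b with
  | _, None => true
  | None, Some _ => false
  | Some m, Some n => (m <= n)%N
  end.

Definition enat_succ (a : enat) : enat := omap S a.

Definition least (P : nat -> Prop) : enat :=
  if pselect (exists n, `[< P n >]) is left exP then Some (ex_minn exP)
  else None.

Definition esup (A : enat -> Prop) : enat :=
  least (fun n => forall a, A a -> enat_le a (Some n)).

Definition Gfd (R : comNzRingType) (M : lmodType R) : enat :=
  least (gorenstein_flat_resolution M).

Definition Gwdim (R : comNzRingType) : enat :=
  esup (fun a => exists M : lmodType R, a = Gfd M).

Lemma leastP (P : nat -> Prop) (a : enat) :
  least P = a <->
  if a is Some n then P n /\ forall m, P m -> (n <= m)%N else forall n, ~ P n.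
Proof.
rewrite /least; case: pselect => [exP|nP].
  case: ex_minnP => n /asboolP Pn le_n; split=> [<-|].
    by split=> // m /asboolP /le_n.
  case: a => [m [Pm le_m]|/(_ n) //].
  by congr Some; apply/eqP; rewrite eqn_leq le_m // le_n //; apply/asboolP.
split=> [<- n Pn|]; first by apply: nP; exists n; apply/asboolP.
by case: a => // n [Pn _]; case: nP; exists n; apply/asboolP.
Qed.

Lemma esupP (A : enat -> Prop) (b : enat) :
  enat_le (esup A) b <-> forall a, A a -> enat_le a b.
Proof.
have := (leastP (fun n => forall a, A a -> enat_le a (Some n)) (esup A)).1 erefl.
case: b => [n|]; last by move=> _; split=> [_ []|]; case: (esup A).
case: (esup A) => [s [ub least_s]|noub]; split=> //=.
- by move=> sn [m|] /ub //= ms; apply: leq_trans ms sn.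
- exact: least_s.
- by move/noub.
Qed.

(* Main.v *)
Require Import Defs.
From HB Require Import structures.
From mathcomp Require Import all_boot all_order all_algebra.
From mathcomp Require Import boolp classical_sets functions.
From mathcomp.multinomials Require Import freeg.

Set Implicit Arguments.
Unset Strict Implicit.
Unset Printing Implicit Defensive.

Import Order.TTheory GRing.Theory Num.Theory.
Local Open Scope ring_scope.

(* Flat dimension is expressed through the vanishing of Tor_1 on syzygies.  Over
   a commutative ring, Gwdim <= n holds exactly when every injective module has
   flat dimension <= n: n-th syzygies of an injective coresolution glue to the
   totally acyclic complexes that make n-th syzygies Gorenstein flat.  Write
   S = R[[x]].
   If E is an injective S-module and 0 -> K -> F -> E -> 0 with F flat, then
   reduction modulo x gives 0 -> (0 :_E x) -> K / xK -> F / xF -> 0, so that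
   (0 :_E x) has R-flat dimension at most fd_S E - 1; every injective R-module
   is a summand of some (0 :_E x).
   Conversely, let Q be an (m+1)-st syzygy of S / I, I a finitely generated
   ideal, where m bounds the flat dimensions of the injective R-modules.  Then
   Tor_1(Q, (0 :_E x)) vanishes and multiplication by x is injective on
   Tor_1(Q, E) for every injective E.  By coherence of S this is dual to
   Ext^1(Q, S) = x Ext^1(Q, S), with Ext^1(Q, S) finitely generated, so Nakayama's
   lemma gives Ext^1(Q, S) = 0, hence Tor_{m+2}(S / I, E) = 0. *)

(** * Linear maps, free modules and tensor products *)

Section LinearMaps.
Variable R : comNzRingType.
Implicit Types A B C M N X I : lmodType R.

(** Tor itself is never constructed: [tor0 M N] asks that flat covers of [M] stay injective when
    tensored with [N]. Diagram chases show that one cover decides this and that the two variables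
    can be exchanged; higher Tor is then moved to Tor_1 by taking syzygies in either variable. The
    syzygy Q starts from S / I for two reasons. First, I lies in S, so every syzygy from I on is
    x-torsion-free and its covers stay exact modulo x. Hence Q / xQ is an m-th syzygy of I / xI over
    R, and Tor_1^S(Q, A) = Tor_1^R(Q / xQ, A) = 0 for A injective over R. The inclusion of I in S
    itself need not stay injective modulo x; the index lost there is the 1 in Gwdim(R) + 1. Second,
    I is finitely generated, so coherence gives Q the start S^c -> S^b -> S^a of a resolution by
    finite free modules, and Tor_1(Q, E) becomes Hom(Ext^1(Q, S), E) for E injective. As E = xE, the
    sequence 0 -> (0 :_E x) -> E -> E -> 0 is exact; this is why a vanishing on (0 :_E x) makes x
    injective on Tor_1(Q, E). *)

Definition linear_of A B (f : A -> B) (lin_f : linear f) : {linear A -> B} :=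
  HB.pack f (GRing.isLinear.Build R A B *:%R f lin_f).

(** Maps defined by choosing preimages are introduced as single-valued linear relations, so that
    linearity does not depend on the choices. *)
Lemma ex_linear A B (P : A -> B -> Prop) :
  (forall x, exists y, P x y) -> (forall x y y', P x y -> P x y' -> y = y') ->
  (forall a x x' y y', P x y -> P x' y' -> P (a *: x + x') (a *: y + y')) ->
  exists f : {linear A -> B}, forall x, P x (f x).
Proof.
move=> /choice[f Pf] uniqP linP.
have lin_f : linear f by move=> a x y; apply: (uniqP (a *: x + y)) => //; apply: linP.
by exists (linear_of lin_f).
Qed.

Definition surj A B (f : A -> B) := forall y, exists x, f x = y.

Definition short_exact A B C (f : {linear A -> B}) (g : {linear B -> C}) :=
  [/\ injective f, exact_at f g & surj g].

Lemma inj0P A B (f : {linear A -> B}) :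
  injective f <-> forall x, f x = 0 -> x = 0.
Proof.
split=> [inj_f x fx|f0 x y fxy]; first by apply: inj_f; rewrite fx linear0.
by apply/eqP; rewrite -subr_eq0; apply/eqP/f0; rewrite linearB fxy subrr.
Qed.

Section Submodules.
Variables (M : lmodType R) (P : M -> Prop).
Hypotheses (P0 : P 0) (PP : forall a x y, P x -> P y -> P (a *: x + y)).

Definition predb (x : M) : bool := `[< P x >].
Fact predb_submod : submod_closed predb.
Proof.
by split=> [|a u v /asboolP Pu /asboolP Pv]; apply/asboolP => //; apply: PP.
Qed.
Definition submod_of : submodClosed M := HB.pack_for (submodClosed M) predb
  (GRing.isSubmodClosed.Build R M predb predb_submod).

Lemma ex_submod : exists (K : lmodType R) (i : {linear K -> M}),
  injective i /\ forall y, P y <-> exists x, i x = y.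
Proof.
exists (submod submod_of).
have lin_val : linear (fun x : submod submod_of => \val x) by [].
exists (linear_of lin_val); split=> [x y|y]; first exact: val_inj.
split=> [Py|[x <-]].
  have yP : y \in submod_of by apply/asboolP.
  by exists (Submod yP).
by have /asboolP := valP x.
Qed.

Lemma ex_quotient : exists (C : lmodType R) (q : {linear M -> C}),
  (forall y, q y = 0 <-> P y) /\ surj q.
Proof.
exists (quotmod submod_of), (qpi submod_of : {linear _ -> _}); split=> [y|y].
  have -> : (qpi submod_of y = 0) <-> (qpi submod_of y = qpi submod_of 0) by rewrite linear0.
  rewrite qpi_eq subr0; split=> [/asboolP|Py] //; exact/asboolP.
by exists (qrepr y); apply: qreprK.
Qed.

End Submodules.
End LinearMaps.
Section Abelian.
Variable R : comNzRingType.
Implicit Types A B C M N X I : lmodType R.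

Lemma ex_kernel A B (f : {linear A -> B}) :
  exists (K : lmodType R) (i : {linear K -> A}), injective i /\ exact_at i f.
Proof.
apply: (@ex_submod R A (fun x => f x = 0)); first exact: linear0.
by move=> a x y fx fy; rewrite linearP fx fy scaler0 addr0.
Qed.

Lemma ex_cokernel A B (f : {linear A -> B}) :
  exists (C : lmodType R) (q : {linear B -> C}), exact_at f q /\ surj q.
Proof.
apply: (@ex_quotient R B (fun y => exists x, f x = y)).
  by exists 0; apply: linear0.
by move=> a _ _ [x <-] [y <-]; exists (a *: x + y); rewrite linearP.
Qed.

Lemma ex_image A B (f : {linear A -> B}) :
  exists (I : lmodType R) (p : {linear A -> I}) (j : {linear I -> B}),
    [/\ surj p, injective j & forall x, j (p x) = f x].
Proof.
have [||I [j [inj_j jP]]] := @ex_submod R B (fun y => exists x, f x = y).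
- by exists 0; apply: linear0.
- by move=> a _ _ [x <-] [y <-]; exists (a *: x + y); rewrite linearP.
have [||| p pP] := @ex_linear R A I (fun x z => j z = f x).
- by move=> x; apply/(jP (f x)); exists x.
- by move=> x z z' <- /inj_j.
- by move=> a x x' z z' zx zx'; rewrite !linearP zx zx'.
exists I, p, j; split=> // z.
by have [x xz] : exists x, f x = j z := (jP _).2 (ex_intro _ z erefl);
  exists x; apply: inj_j; rewrite pP.
Qed.

Lemma factor_mono A B X (j : {linear A -> B}) (g : {linear X -> B}) :
  injective j -> (forall x, exists a, j a = g x) ->
  exists h : {linear X -> A}, forall x, j (h x) = g x.
Proof.
move=> inj_j jg; apply: (@ex_linear R X A (fun x a => j a = g x)) => //.
  by move=> x y y' <- /inj_j.
by move=> a x x' y y' e e'; rewrite !linearP e e'.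
Qed.

Lemma factor_epi A B X (q : {linear A -> B}) (g : {linear A -> X}) :
  surj q -> (forall x, q x = 0 -> g x = 0) ->
  exists h : {linear B -> X}, forall x, h (q x) = g x.
Proof.
move=> surj_q qg.
have eqg x x' : q x = q x' -> g x = g x'.
  by move=> e; apply/eqP; rewrite -subr_eq0 -linearB qg ?linearB ?e ?subrr.
have [||| h hP] := @ex_linear R B X (fun y z => exists2 x, q x = y & g x = z).
- by move=> y; have [x xy] := surj_q y; exists (g x), x.
- by move=> y z z' [x <- <-] [x' /eqg -> <-].
- by move=> a y y' z z' [x <- <-] [x' <- <-]; exists (a *: x + x'); rewrite linearP.
by exists h => x; have [x' /eqg xx' <-] := hP (q x).
Qed.

Lemma ex_short_exact_mono A B (f : {linear A -> B}) : injective f ->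
  exists (C : lmodType R) (g : {linear B -> C}), short_exact f g.
Proof. by have [C [g []]] := ex_cokernel f; exists C, g. Qed.

Lemma ex_short_exact_epi B C (g : {linear B -> C}) : surj g ->
  exists (A : lmodType R) (f : {linear A -> B}), short_exact f g.
Proof. by have [A [f []]] := ex_kernel g; exists A, f. Qed.

Lemma exact0 A B C (f : {linear A -> B}) (g : {linear B -> C}) x :
  exact_at f g -> g (f x) = 0.
Proof. by move=> fg; apply/fg; exists x. Qed.

(* An injective module extends along any map, not only along injections, what
   factors through its image. *)
Lemma injective_extend A B I (f : {linear A -> B}) (g : {linear A -> I}) :
  injective_module I -> (forall x, f x = 0 -> g x = 0) ->
  exists h : {linear B -> I}, forall x, h (f x) = g x.
Proof.
move=> injI fg; have [J [p [j [surj_p inj_j jp]]]] := ex_image f.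
have [|h hp] := @factor_epi _ _ _ p g surj_p.
  by move=> x px; apply: fg; rewrite -jp px linear0.
by have [k kj] := injI _ _ j h inj_j; exists k => x; rewrite -jp kj hp.
Qed.

Lemma ex_zero_module : exists Z : lmodType R, forall x : Z, x = 0.
Proof.
have [||Z [i [inj_i iP]]] := @ex_submod R R^o (fun x => x = 0).
- by [].
- by move=> a x y -> ->; rewrite scaler0 addr0.
by exists Z => x; apply: inj_i; rewrite linear0; apply/iP; exists x.
Qed.

Definition zerol A B : {linear A -> B} := \0.
Definition idl A : {linear A -> A} := idfun.
Definition compl A B C (g : {linear B -> C}) (f : {linear A -> B}) :
  {linear A -> C} := g \o f.
Definition fstl A B : {linear (A * B)%type -> A} := fst.
Definition sndl A B : {linear (A * B)%type -> B} := snd.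

Fact inll_lin A B : linear (fun a : A => (a, 0) : (A * B)%type).
Proof. by move=> a x y; apply/pair_equal_spec; rewrite /= scaler0 addr0. Qed.
Definition inll A B := linear_of (@inll_lin A B).
Fact inrl_lin A B : linear (fun b : B => (0, b) : (A * B)%type).
Proof. by move=> a x y; apply/pair_equal_spec; rewrite /= scaler0 addr0. Qed.
Definition inrl A B := linear_of (@inrl_lin A B).

Fact addl_lin A B C (f : {linear A -> C}) (g : {linear B -> C}) :
  linear (fun u : (A * B)%type => f u.1 + g u.2).
Proof. by move=> a x y /=; rewrite !linearP scalerDr addrACA. Qed.
Definition addl A B C f g := linear_of (@addl_lin A B C f g).

Fact scalel_lin A r : linear (fun u : A => r *: u).
Proof. by move=> a x y; rewrite scalerDr !scalerA mulrC. Qed.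
Definition scalel A r := linear_of (@scalel_lin A r).

Fact eltl_lin M (m : M) : linear (fun r : R^o => r *: m).
Proof. by move=> a x y; rewrite scalerDl -scalerA. Qed.
Definition eltl M m := linear_of (@eltl_lin M m).

End Abelian.

Section Free.
Variable R : comNzRingType.
Implicit Types A B C M N X I : lmodType R.

Definition free_lift (K : choiceType) M (f : K -> M) :
  {linear {freeg K / R} -> M} := linear_of (fglift_is_linear f).

Lemma free_liftU (K : choiceType) M (f : K -> M) k : free_lift f << k >> = f k.
Proof. by rewrite /free_lift /= liftU scale1r. Qed.

Lemma freeg_scaleU (K : choiceType) (c : R) (k : K) : << c *g k >> = c *: << k >>.
Proof.
by apply/eqP/freeg_eqP => t; rewrite coeffZ !coeffU mulrA mulr1.
Qed.

Lemma freeg_ind (K : choiceType) (P : {freeg K / R} -> Prop) :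
  P 0 -> (forall c k u, P u -> P (c *: << k >> + u)) -> forall u, P u.
Proof.
move=> P0 PD u; rewrite -(freeg_sumE u).
elim: (dom u) => [|k s ih]; first by rewrite big_nil.
by rewrite big_cons freeg_scaleU; apply: PD.
Qed.

Lemma free_ext (K : choiceType) M (f g : {linear {freeg K / R} -> M}) :
  (forall k, f << k >> = g << k >>) -> f =1 g.
Proof.
move=> fg u; elim/freeg_ind: u => [|c k u ih]; first by rewrite !linear0.
by rewrite !linearP ih fg.
Qed.

Lemma ex_free_cover M : exists (K : choiceType) (p : {linear {freeg K / R} -> M}), surj p.
Proof. by exists M, (free_lift id) => m; exists << m >>; rewrite free_liftU. Qed.

End Free.

Section Tensors.
Variable R : comNzRingType.
Implicit Types A B C M N T Q : lmodType R.

Lemma tensor_ind M N (P : tensor M N -> Prop) :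
  P 0 -> (forall m n t, P t -> P (tens m n + t)) -> forall t, P t.
Proof.
move=> P0 PD t; rewrite -(qreprK t); elim/freeg_ind: (qrepr t) => [|c [m n] u ih].
  by rewrite linear0.
have -> : qpi (tensor_sub M N) (c *: << (m, n) >> + u) =
    tens (c *: m) n + qpi (tensor_sub M N) u by rewrite linearP tensZl.
exact: PD.
Qed.

Lemma tensor_ext M N T (f g : {linear tensor M N -> T}) :
  (forall m n, f (tens m n) = g (tens m n)) -> f =1 g.
Proof.
move=> fg; elim/tensor_ind => [|m n t ih]; first by rewrite !linear0.
by rewrite !linearD fg ih.
Qed.

Lemma tensor_univ M N T (b : M -> N -> T) :
  (forall n, linear (b^~ n)) -> (forall m, linear (b m)) ->
  exists f : {linear tensor M N -> T}, forall m n, f (tens m n) = b m n.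
Proof.
move=> bl br.
have blD m m' n : b (m + m') n = b m n + b m' n.
  by have := bl n 1 m m'; rewrite !scale1r.
have brD m n n' : b m (n + n') = b m n + b m n'.
  by have := br m 1 n n'; rewrite !scale1r.
have b0l n : b 0 n = 0 by have := blD 0 0 n; rewrite addr0 => /esym/eqP; rewrite -subr_eq0 addrK => /eqP.
have b0r m : b m 0 = 0 by have := brD m 0 0; rewrite addr0 => /esym/eqP; rewrite -subr_eq0 addrK => /eqP.
have blZ a m n : b (a *: m) n = a *: b m n by have := bl n a m 0; rewrite !addr0 b0l addr0.
have brZ a m n : b m (a *: n) = a *: b m n by have := br m a n 0; rewrite !addr0 b0r addr0.
have [||f fP] := @factor_epi R _ _ _ (qpi (tensor_sub M N)) (free_lift (fun mn => b mn.1 mn.2)).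
- by move=> t; exists (qrepr t); apply: qreprK.
(* [qpi u = 0] is turned into [qpi u = qpi 0], hence into [tensor_rel u], on which induction is
   possible. *)
- move=> u /(@etrans _ _ _ _)/(_ (esym (linear0 (qpi (tensor_sub M N))))).
  move/qpi_eq; rewrite subr0 => /asboolP.
  elim=> [|a v w _ vE _ wE|m m' n|m n n'|a m n|a m n].
  + exact: linear0.
  + by rewrite linearP vE wE scaler0 addr0.
  + by rewrite !linearB !free_liftU /= blD addrAC addrK subrr.
  + by rewrite !linearB !free_liftU /= brD addrAC addrK subrr.
  + by rewrite linearB linearZ !free_liftU /= blZ subrr.
  + by rewrite linearB linearZ !free_liftU /= brZ subrr.
by exists f => m n; rewrite fP free_liftU.
Qed.

Lemma tens_linl M N (n : N) : linear (fun m : M => tens m n).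
Proof. by move=> a x y; rewrite tensDl tensZl. Qed.
Lemma tens_linr M N (m : M) : linear (fun n : N => tens m n).
Proof. by move=> a x y; rewrite tensDr tensZr. Qed.
Definition tensl M N (n : N) := linear_of (@tens_linl M N n).
Definition tensr M N (m : M) := linear_of (@tens_linr M N m).
Lemma tens0l M N (n : N) : tens (0 : M) n = 0.
Proof. exact: (linear0 (tensl M n)). Qed.
Lemma tens0r M N (m : M) : tens m (0 : N) = 0.
Proof. exact: (linear0 (tensr N m)). Qed.

Lemma ex_tensor_mapr M A B (f : {linear A -> B}) :
  exists g : {linear tensor M A -> tensor M B}, forall m a, g (tens m a) = tens m (f a).
Proof.
apply: (@tensor_univ _ _ _ (fun m a => tens m (f a))).
  by move=> n a x y; rewrite tensDl tensZl.
by move=> n a x y; rewrite linearP tensDr tensZr.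
Qed.

Lemma ex_tensor_swap M N :
  exists g : {linear tensor M N -> tensor N M}, forall m n, g (tens m n) = tens n m.
Proof.
apply: (@tensor_univ _ _ _ (fun m n => tens n m)).
  by move=> n a x y; rewrite tensDr tensZr.
by move=> n a x y; rewrite tensDl tensZl.
Qed.

Lemma tensor_map_comp N A B C (g : {linear B -> C}) (f : {linear A -> B})
    (h : {linear A -> C}) : (forall x, g (f x) = h x) ->
  forall t, tensor_map N g (tensor_map N f t) = tensor_map N h t.
Proof.
move=> gf; elim/tensor_ind => [|a n t ih]; first by rewrite !linear0.
by rewrite !linearD /= ih !tensor_mapE gf.
Qed.

Lemma tensor_map_surj N A B (f : {linear A -> B}) : surj f -> surj (tensor_map N f).
Proof.
move=> sf; elim/tensor_ind => [|b n t [t' <-]]; first by exists 0; rewrite linear0.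
by have [a <-] := sf b; exists (tens a n + t'); rewrite linearD /= tensor_mapE.
Qed.

(** For the nontrivial inclusion, sending [(g b, n)] to the class of [tens b n] is well defined and
    bilinear from [C] and [N] to the cokernel of [tensor_map N f]. The projection onto this cokernel
    thus factors through [tensor_map N g]. *)
Lemma tensor_right_exact N A B C (f : {linear A -> B}) (g : {linear B -> C}) :
  exact_at f g -> surj g -> exact_at (tensor_map N f) (tensor_map N g).
Proof.
move=> fg sg t; split=> [|[u <-]]; last first.
  rewrite (@tensor_map_comp _ _ _ _ g f \0); last by move=> x; apply: exact0.
  elim/tensor_ind: u => [|a n u ih]; first by rewrite linear0.
  by rewrite linearD /= ih tensor_mapE tens0l addr0.
have [Q [q [qP sq]]] := ex_cokernel (tensor_map N f).
have qf a n : q (tens (f a) n) = 0 by apply/qP; exists (tens a n); rewrite /= tensor_mapE.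
have hP n : exists h : {linear C -> Q}, forall b, h (g b) = q (tens b n).
  apply: (@factor_epi R _ _ _ g (compl q (tensl B n)) sg) => b /fg[a <-]; exact: qf.
have [h hE] := choice hP.
have [||k kP] := @tensor_univ C N Q (fun c n => h n c).
- by move=> n a x y; rewrite linearP.
- move=> c a n n'; have [b <-] := sg c; rewrite !hE.
  by rewrite tensDr tensZr linearP.
move=> gt; apply/qP.
have -> : q t = k (tensor_map N g t).
  elim/tensor_ind: t {gt} => [|b n t ih]; first by rewrite !linear0.
  by rewrite !linearD /= -ih tensor_mapE kP hE.
by rewrite gt linear0.
Qed.

(* Exchanges the roles of the two factors in the injectivity statements below. *)
Lemma tensor_map_swap_inj M A B (f : {linear A -> B})
    (g : {linear tensor M A -> tensor M B}) :
  (forall m a, g (tens m a) = tens m (f a)) ->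
  injective (tensor_map M f) <-> injective g.
Proof.
move=> gE.
have [s sE] := ex_tensor_swap M A; have [s' s'E] := ex_tensor_swap A M.
have [r rE] := ex_tensor_swap M B; have [r' r'E] := ex_tensor_swap B M.
have s'K t : s (s' t) = t.
  by apply: (tensor_ext (f := compl s s') (g := idl _)) => m n /=; rewrite s'E sE.
have sK t : s' (s t) = t.
  by apply: (tensor_ext (f := compl s' s) (g := idl _)) => m n /=; rewrite sE s'E.
have rK t : r' (r t) = t.
  by apply: (tensor_ext (f := compl r' r) (g := idl _)) => m n /=; rewrite rE r'E.
have sr t : r (g t) = tensor_map M f (s t).
  apply: (tensor_ext (f := compl r g) (g := compl (tensor_map M f) s)) => m n /=.
  by rewrite gE rE sE tensor_mapE.
split=> /inj0P inj; apply/inj0P => t tE.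
  have e : r (g t) = 0 by rewrite tE linear0.
  by rewrite -(sK t) (inj (s t)) ?linear0 // -e sr.
have e : tensor_map M f t = 0 := tE.
by rewrite -(s'K t) (inj (s' t)) ?linear0 // -(rK (g _)) sr s'K e linear0.
Qed.

End Tensors.

(** * Baer's criterion *)

Section Baer.
Variable R : comNzRingType.
Implicit Types A B C D M N X : lmodType R.

Definition baer D := forall (J : R -> Prop) (g : R -> D),
  J 0 -> (forall a r s, J r -> J s -> J (a * r + s)) ->
  (forall a r s, J r -> J s -> g (a * r + s) = a *: g r + g s) ->
  exists d, forall r, J r -> g r = r *: d.

Section Extension.
Variables (B D : lmodType R) (G0 : B -> D -> Prop).

Definition partial_linear (G : set (B * D)%type) :=
  [/\ forall x y, G0 x y -> G (x, y),
      forall a u v, G u -> G v -> G (a *: u + v)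
    & forall y, G (0, y) -> y = 0].

(** Zorn's lemma on graphs of partial linear maps containing [G0]. At a maximal graph, Baer's
    condition for the ideal of all [r] with [r *: b] in the domain shows that [b] is in the domain
    too. *)
Lemma baer_relation : baer D -> G0 0 0 -> partial_linear (fun u => G0 u.1 u.2) ->
  exists h : {linear B -> D}, forall x y, G0 x y -> h x = y.
Proof.
move=> baerD G00 G0P.
pose T := {G | partial_linear G}.
pose le (s t : T) := `[< sval s `<=` sval t >]%classic.
have [|||| [G GPP] Gmax] := @Zorn T le.
- by move=> t; apply/asboolP.
- by move=> r s t /asboolP rs /asboolP st; apply/asboolP => x /rs /st.
- by move=> [s Ps] [t Pt] /asboolP st /asboolP ts; apply/eq_exist/seteqP.
(* An empty chain is bounded by the given relation; the union of a chain contains [G0] only if the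
   chain has a member. *)
- move=> F totF; have [[s0 Fs0]|F0] := pselect (exists s, F s); last first.
    by exists (exist _ _ G0P) => s Fs; case: F0; exists s.
  have UP : partial_linear (fun u => exists2 s, F s & sval s u).
    split=> [x y xy|a u v [s Fs su] [t Ft tv]|y [s Fs sy]].
    + by exists s0 => //; case: (svalP s0) => + _ _; apply.
    + have [/asboolP st|/asboolP ts] := totF _ _ Fs Ft.
        by exists t => //; case: (svalP t) => _ + _; apply => //; apply: st.
      by exists s => //; case: (svalP s) => _ + _; apply => //; apply: ts.
    + by case: (svalP s) => _ _; apply.
  by exists (exist _ _ UP) => s Fs; apply/asboolP => u su; exists s.
have [G0G GP Gf] := GPP.
have G00' : G (0, 0) by apply: G0G.
have Gtot b : exists y, G (b, y).
  pose J r := exists y, G (r *: b, y).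
  have [|g gP] := @choice R D (fun r y => J r -> G (r *: b, y)).
    by move=> r; have [[y]|nJ] := pselect (J r); [exists y|exists 0].
  have Guniq x y y' : G (x, y) -> G (x, y') -> y = y'.
    move=> Gy Gy'; apply/eqP; rewrite -subr_eq0; apply/eqP/Gf.
    have := GP (-1) _ _ Gy' Gy.
    rewrite (_ : -1 *: (x, y') + (x, y) = (0, y - y')) //.
    by apply/pair_equal_spec; rewrite /= !scaleN1r addNr addrC.
  have J0 : J 0 by exists 0; rewrite scale0r.
  have JP a r s : J r -> J s -> J (a * r + s).
    move=> [y Gy] [z Gz]; exists (a *: y + z); have := GP a _ _ Gy Gz.
    by rewrite /= scalerDl -scalerA.
  have [a r s Jr Js|d dP] := baerD J g J0 JP.
    apply: (Guniq ((a * r + s) *: b)); first by apply/gP/JP.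
    by have := GP a _ _ (gP _ Jr) (gP _ Js); rewrite /= scalerDl -scalerA.
  (* The graph grown by the multiples of [(b, d)]. It stays single-valued because [d] gives the
     values already prescribed at the multiples of [b] in the domain. *)
  pose G' : set (B * D)%type := fun u => exists r v, G v /\ u = v + r *: (b, d).
  have G'P : partial_linear G'.
    split=> [x y xy|a _ _ [r [v [Gv ->]]] [s [w [Gw ->]]]|y [r [[x z] [Gv]]]].
    + by exists 0, (x, y); split; [apply: G0G|rewrite scale0r addr0].
    + exists (a * r + s), (a *: v + w); split; first exact: GP.
      by rewrite scalerDr scalerDl scalerA addrACA.
    + move=> /pair_equal_spec[/= e ->].
      have xE : x = (- r) *: b by apply/eqP; rewrite scaleNr -addr_eq0 -e.
      have Jr : J (- r) by exists z; rewrite -xE.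
      rewrite (Guniq _ _ _ Gv (_ : G (x, - r *: d))) ?scaleNr ?addNr //.
      by rewrite xE -scaleNr -dP //; apply: gP.
  have Gb : G' (b, d) by exists 1, 0; rewrite add0r scale1r.
  have GG' : le (exist _ G GPP) (exist _ G' G'P).
    by apply/asboolP => v Gv; exists 0, v; rewrite scale0r addr0.
  by have /(congr1 sval)/= e := Gmax _ GG'; exists d; rewrite -e.
have [||h hP] := @ex_linear R B D (fun x y => G (x, y)) Gtot.
- move=> x y y' Gy Gy'; apply/eqP; rewrite -subr_eq0; apply/eqP/Gf.
  have := GP (-1) _ _ Gy' Gy.
  rewrite (_ : -1 *: (x, y') + (x, y) = (0, y - y')) //.
  by apply/pair_equal_spec; rewrite /= !scaleN1r addNr addrC.
- by move=> a x x' y y'; apply: GP.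
exists h => x y /G0G Gxy; apply/eqP; rewrite -subr_eq0; apply/eqP/Gf.
have := GP (-1) _ _ Gxy (hP x).
rewrite (_ : -1 *: (x, y) + (x, h x) = (0, h x - y)) //.
by apply/pair_equal_spec; rewrite /= !scaleN1r addNr addrC.
Qed.

End Extension.

Lemma baer_injective D : baer D -> injective_module D.
Proof.
move=> baerD A B i f /inj0P i0.
have [||h hP] := @baer_relation B D (fun b d => exists2 a, i a = b & f a = d) baerD.
- by exists 0; rewrite linear0.
- split=> [//|a [b d] [b' d'] [x /= <- <-] [y /= <- <-]|y [x /= /i0 -> <-]].
    by exists (a *: x + y); rewrite linearP.
  by rewrite linear0.
by exists h => x; apply: hP; exists x.
Qed.

End Baer.

(** * Injective cogenerators *)

Section RationalsModIntegers.

Lemma int_ideal (J : int -> Prop) : J 0 ->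
  (forall a r s, J r -> J s -> J (a * r + s)) ->
  exists n : nat, J n%:Z /\ forall r, J r -> exists c, r = c * n%:Z.
Proof.
move=> J0 JP.
have JN r : J r -> J (- r) by move=> Jr; rewrite -mulN1r -[_ * _]addr0; apply: JP.
have [[r [Jr r0]]|nJ] := pselect (exists r, J r /\ r <> 0); last first.
  exists 0%N; split=> // r Jr; exists 0; rewrite mul0r.
  by apply: contrapT => r0; apply: nJ; exists r.
have exJ : exists n, `[< J n%:Z /\ (0 < n)%N >].
  exists `|r|%N; apply/asboolP; split; last by rewrite absz_gt0; apply/eqP.
  by have [r_ge|r_lt] := lerP 0 r; [rewrite gez0_abs|rewrite ltz0_abs //; apply: JN].
case: (ex_minnP exJ) => n /asboolP[Jn n0] minn; exists n; split=> // s Js.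
exists (s %/ n)%Z; rewrite {1}(divz_eq s n).
have Jm : J (s %% n)%Z.
  have -> : (s %% n)%Z = - (s %/ n)%Z * n%:Z + s.
    by rewrite {3}(divz_eq s n) mulNr addKr.
  exact: JP.
have m_ge0 : (0 <= s %% n)%Z by apply: modz_ge0; rewrite eqz_nat -lt0n.
have m_lt : (s %% n < n)%Z by apply: ltz_pmod.
have [m [mE]] : exists m : nat, (s %% n)%Z = m by exists `|(s %% n)%Z|%N; rewrite gez0_abs.
rewrite mE in Jm m_lt *; case: m {mE} => [|m] in Jm m_lt *; first by rewrite addr0.
have : (n <= m.+1)%N by apply: minn; apply/asboolP.
by rewrite leqNgt -ltz_nat m_lt.
Qed.

Lemma int_linear (U V : lmodType int) (f : U -> V) :
  (forall x y, f (x + y) = f x + f y) -> linear f.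
Proof.
move=> fD a x y; rewrite fD; congr (_ + _).
have f0 : f 0 = 0 by apply: (addrI (f 0)); rewrite -fD !addr0.
have fN z : f (- z) = - f z by apply/eqP; rewrite -addr_eq0 -fD addNr f0.
have fn (n : nat) z : f (z *+ n) = f z *+ n.
  by elim: n => [|n ih]; rewrite ?mulr0n // !mulrS fD ih.
rewrite -[a]intz !scaler_int; case: a => n; first exact: fn.
by rewrite NegzE !mulrNz fN -!pmulrn fn.
Qed.

(** [D] is Q/Z: it is divisible and ideals of the integers are principal, which gives Baer's
    condition. *)
Lemma ex_int_cogenerator : exists D : lmodType int, injective_module D /\
  forall (M : lmodType int) (m : M), m <> 0 -> exists f : {linear M -> D}, f m <> 0.
Proof.
have [||D [q [qP sq]]] := @ex_quotient int (zmodule rat) (fun x : rat => x \is a Num.int).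
- exact: rpred0.
- by move=> a x y xZ yZ; rewrite scalezrE rpredD // rpredMz.
have divD (n : nat) (d : D) : (0 < n)%N -> exists e, n%:Z *: e = d.
  move=> n0; have [x <-] := sq d; exists (q ((x : rat) / n%:R)).
  rewrite -linearZ; congr (q _).
  by rewrite scalezrE -mulrzr mulfVK // pnatr_eq0 -lt0n.
have injD : injective_module D.
  apply: baer_injective => J g J0 JP gP.
  have [n [Jn nP]] := int_ideal J0 JP.
  have g0 : g 0 = 0.
    have := gP (-1) 0 0 J0 J0; rewrite mulr0 addr0 scaleN1r addNr //.
  case: n => [|n] in Jn nP *.
    by exists 0 => r /nP[c ->]; rewrite mulr0 g0 scaler0.
  have [d dE] := divD n.+1 (g n.+1%:Z) isT; exists d => r /nP[c ->].
  by rewrite -[c * _]addr0 gP // g0 !addr0 -dE scalerA.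
exists D; split=> // M m m0.
have [||n [nm nP]] := @int_ideal (fun k => k *: m = 0); first exact: scale0r.
  by move=> a r s rm sm; rewrite scalerDl -scalerA rm sm scaler0 addr0.
have [d d0 nd] : exists2 d : D, d <> 0 & n%:Z *: d = 0.
  have qV k : (1 < k)%N -> q (k%:R^-1 : rat) <> 0.
    move=> k1 /qP/intrP[z zE].
    have : (z * k%:Z)%:~R = 1%:~R :> rat.
      by rewrite intrM -zE mulVf // pnatr_eq0 -lt0n ltnW.
    move/eqP; rewrite eqr_int => /eqP zk1.
    have : (k%:Z %| z * k%:Z)%Z by rewrite dvdz_mull.
    by rewrite zk1 dvdz1 => /eqP /= k1'; rewrite k1' in k1.
  (* [n] generates the annihilator of [m], and [d] must be nonzero and killed by [n]. The class of
     1/n serves for n >= 2, that of 1/2 for n = 0, and n = 1 would force m = 0. *)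
  case: n => [|[|n]] in nm nP *.
  - by exists (q (2%:R^-1 : rat)); rewrite ?scale0r //; apply: qV.
  - by case: m0; rewrite scale1r in nm.
  - exists (q (n.+2%:R^-1 : rat)); first exact: qV.
    rewrite -linearZ; apply/qP; rewrite scalezrE -mulrzr mulVf ?rpred1 //.
    by rewrite pnatr_eq0.
have [k /nP[c ->]|h hE] := @injective_extend _ _ _ D (eltl m) (eltl d) injD.
  by rewrite /eltl /= -scalerA nd scaler0.
by exists h => hm; apply: d0; have := hE 1; rewrite /eltl /= !scale1r hm.
Qed.

End RationalsModIntegers.

Section Coinduced.
Variables (R : comNzRingType) (D : lmodType int).

Definition additive_pred (f : R -> D) : bool :=
  `[< forall x y, f (x + y) = f x + f y >].
Fact additive_pred_zmod : zmod_closed additive_pred.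
Proof.
split=> [|f g /asboolP fD /asboolP gD]; apply/asboolP => x y.
  by rewrite addr0.
by rewrite !fctE fD gD opprD addrACA.
Qed.
HB.instance Definition _ := GRing.isZmodClosed.Build (R -> D) additive_pred
  additive_pred_zmod.

(* Hom_Z(R, D), with R acting on the argument. *)
Record coinduced : Type :=
  Coinduced { coind_val :> R -> D; _ : coind_val \in additive_pred }.
HB.instance Definition _ := [isSub for coind_val].
HB.instance Definition _ := [Choice of coinduced by <:].
HB.instance Definition _ := [SubChoice_isSubZmodule of coinduced by <:].

Lemma coinducedD (f : coinduced) x y : f (x + y) = f x + f y.
Proof. by case: f => f /= /asboolP. Qed.

Lemma coinducedP (f g : coinduced) : (forall x, f x = g x) -> f = g.
Proof. by move=> fg; apply: val_inj; apply/funext. Qed.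

Fact coind_scale_subproof a (f : coinduced) : (fun x => f (a * x)) \in additive_pred.
Proof. by apply/asboolP => x y; rewrite mulrDr coinducedD. Qed.
Definition coind_scale a f := Coinduced (coind_scale_subproof a f).

Fact coind_scaleA a b f : coind_scale a (coind_scale b f) = coind_scale (a * b) f.
Proof. by apply: coinducedP => x /=; rewrite mulrCA mulrA. Qed.
Fact coind_scale1 : left_id 1 coind_scale.
Proof. by move=> f; apply: coinducedP => x /=; rewrite mul1r. Qed.
Fact coind_scaleDr : right_distributive coind_scale +%R.
Proof. by move=> a f g; apply: coinducedP. Qed.
Fact coind_scaleDl f : {morph coind_scale^~ f : a b / a + b}.
Proof. by move=> a b; apply: coinducedP => x /=; rewrite mulrDl coinducedD. Qed.
HB.instance Definition _ := GRing.Zmodule_isLmodule.Build R coinduced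
  coind_scaleA coind_scale1 coind_scaleDr coind_scaleDl.

Lemma coind_addE (f g : coinduced) x : (f + g) x = f x + g x. Proof. by []. Qed.
Lemma coind_scaleE a (f : coinduced) x : (a *: f) x = f (a * x). Proof. by []. Qed.

Lemma ex_coinduced_map (B : lmodType R) (g : {linear zmodule B -> D}) :
  exists h : {linear B -> coinduced}, forall b x, h b x = g (x *: b).
Proof.
have hP b : (fun x : R => g (x *: b)) \in additive_pred.
  by apply/asboolP => x y; rewrite scalerDl (linearD g).
have lin_h : linear (fun b => Coinduced (hP b)).
  move=> a b b'; apply: coinducedP => x; rewrite coind_addE coind_scaleE /=.
  by rewrite scalerDr (linearD g) scalerA mulrC.
by exists (linear_of lin_h).
Qed.

(** The adjunction Hom_R(B, Hom_Z(R, D)) = Hom_Z(B, D): evaluation at 1 turns [f] into an additive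
    map to [D], which is extended there, and [ex_coinduced_map] goes back. *)
Lemma coinduced_injective : injective_module D -> injective_module coinduced.
Proof.
move=> injD A B i f inj_i.
have lin_i : linear (i : zmodule A -> zmodule B).
  by apply: int_linear => x y; apply: (linearD i).
have lin_f : linear ((fun a => f a 1) : zmodule A -> D).
  by apply: int_linear => x y; rewrite (linearD f).
have [g gE] := injD _ _ (linear_of lin_i) (linear_of lin_f) inj_i.
have [h hE] := ex_coinduced_map g.
exists h => x; apply: coinducedP => r; rewrite hE.
have -> : r *: i x = linear_of lin_i (r *: x) by rewrite /= linearZ.
by rewrite gE /= linearZ coind_scaleE mulr1.
Qed.

End Coinduced.

Section EnoughInjectives.
Variable R : comNzRingType.
Implicit Types A B C D M N X : lmodType R.

Definition cogenerator D := forall M (m : M), (forall f : {linear M -> D}, f m = 0) -> m = 0.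

Lemma ex_injective_cogenerator : exists D, injective_module D /\ cogenerator D.
Proof.
have [D [injD cogD]] := ex_int_cogenerator.
exists (coinduced R D); split; first exact: coinduced_injective.
move=> M m fm; apply: contrapT => m0.
have [g gm] := cogD (zmodule M) m m0.
have [h hE] := ex_coinduced_map g; apply: gm.
by rewrite -(scale1r (m : M)) -hE fm.
Qed.

(** Evaluation embeds [M] in the power of an injective cogenerator [D] indexed by Hom(M, D); maps
    into this power extend component by component. *)
Lemma ex_injective_embedding M :
  exists (E : lmodType R) (i : {linear M -> E}), injective_module E /\ injective i.
Proof.
have [D [injD cogD]] := ex_injective_cogenerator.
have lin_ev : linear (fun (m : M) (f : {linear M -> D}) => f m).
  by move=> a x y; apply/funext => f; rewrite linearP.
exists ({linear M -> D} -> D), (linear_of lin_ev); split; last first.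
  by apply/inj0P => m /= /funeqP m0; apply: cogD => f; apply: m0.
move=> A B i f inj_i.
have ex_g (k : {linear M -> D}) : exists g : {linear B -> D}, forall a, g (i a) = f a k.
  have lin_k : linear (fun a => f a k) by move=> c x y; rewrite linearP.
  exact: (injD _ _ i (linear_of lin_k) inj_i).
have [g gE] := choice ex_g.
have lin_g : linear (fun b k => g k b : D) by move=> c x y; apply/funext => k; rewrite linearP.
by exists (linear_of lin_g) => a; apply/funext => k /=; rewrite gE.
Qed.

End EnoughInjectives.

(** * Flat modules *)

Section Flat.
Variable R : comNzRingType.
Implicit Types A B C D M N X F P : lmodType R.

Lemma flat_inj F A B (f : {linear A -> B}) :
  flat F -> injective f -> injective (tensor_map F f).
Proof.
move=> flatF inj_f; apply/inj0P => t.
have ex0 : exact_at (zerol A A) f.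
  by move=> y; split=> [fy|[x <-]]; [exists 0; apply: inj_f; rewrite fy !linear0|rewrite linear0].
move=> /(flatF _ _ _ _ _ ex0)[u <-].
elim/tensor_ind: u => [|a n u ih]; first by rewrite linear0.
by rewrite linearD /= ih tensor_mapE tens0l addr0.
Qed.

Lemma flat_inj0 F A B (f : {linear A -> B}) t :
  flat F -> injective f -> tensor_map F f t = 0 -> t = 0.
Proof. by move=> flatF inj_f ft; apply: (flat_inj flatF inj_f); rewrite /= ft linear0. Qed.

Lemma flatP F : (forall A B (f : {linear A -> B}), injective f ->
  injective (tensor_map F f)) -> flat F.
Proof.
move=> injF A B C f g fg.
have [I [p [j [sp ij jp]]]] := ex_image g.
have fp : exact_at f p.
  move=> y; rewrite -fg -jp; split=> [->|e]; first by rewrite linear0.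
  by apply: ij; rewrite e linear0.
move=> t; rewrite -(tensor_map_comp jp) -(tensor_right_exact fp sp).
split=> [e|->]; last by rewrite linear0.
by apply: (injF _ _ _ ij); rewrite e linear0.
Qed.

Lemma flat_retract F P (i : {linear F -> P}) (r : {linear P -> F}) :
  (forall x, r (i x) = x) -> flat P -> flat F.
Proof.
move=> rK flatP'; apply: flatP => A B f inj_f; apply/inj0P => t ft.
have [iA iAE] := ex_tensor_mapr A i; have [rA rAE] := ex_tensor_mapr A r.
have [iB iBE] := ex_tensor_mapr B i.
have <- : rA (iA t) = t.
  by apply: (tensor_ext (f := compl rA iA) (g := idl _)) => a x /=; rewrite iAE rAE rK.
rewrite (flat_inj0 (t := iA t) flatP' inj_f) ?linear0 //.
have -> : tensor_map P f (iA t) = iB (tensor_map F f t).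
  apply: (tensor_ext (f := compl (tensor_map P f) iA) (g := compl iB (tensor_map F f))).
  by move=> a x /=; rewrite iAE !tensor_mapE iBE.
by rewrite ft linear0.
Qed.

Lemma flat_prod F P : flat F -> flat P -> flat (F * P)%type.
Proof.
move=> flatF flatP'; apply: flatP => A B f inj_f; apply/inj0P => t ft.
have [p1 p1E] := ex_tensor_mapr A (fstl F P); have [p2 p2E] := ex_tensor_mapr A (sndl F P).
have [q1 q1E] := ex_tensor_mapr B (fstl F P); have [q2 q2E] := ex_tensor_mapr B (sndl F P).
have [i1 i1E] := ex_tensor_mapr A (inll F P); have [i2 i2E] := ex_tensor_mapr A (inrl F P).
have -> : t = i1 (p1 t) + i2 (p2 t).
  elim/tensor_ind: t {ft} => [|a x t ih]; first by rewrite !linear0 addr0.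
  rewrite !linearD addrACA -ih p1E p2E i1E i2E -tensDr; congr (tens a _ + t).
  by case: x => x y; apply/pair_equal_spec; rewrite /= addr0 add0r.
rewrite (flat_inj0 (t := p1 t) flatF inj_f); last first.
  have -> : tensor_map F f (p1 t) = q1 (tensor_map _ f t).
    apply: (tensor_ext (f := compl (tensor_map F f) p1) (g := compl q1 (tensor_map _ f))).
    by move=> a x /=; rewrite p1E !tensor_mapE q1E.
  by rewrite ft linear0.
rewrite (flat_inj0 (t := p2 t) flatP' inj_f); last first.
  have -> : tensor_map P f (p2 t) = q2 (tensor_map _ f t).
    apply: (tensor_ext (f := compl (tensor_map P f) p2) (g := compl q2 (tensor_map _ f))).
    by move=> a x /=; rewrite p2E !tensor_mapE q2E.
  by rewrite ft linear0.
by rewrite !linear0 addr0.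
Qed.

(** Functionals replace the decomposition into a direct sum of copies of [A]. For [chi] into an
    injective cogenerator, each [chi (tens - << k >>)] extends along [f], and these extensions
    assemble to a functional through which [chi] factors. An element killed by [tensor_map _ f] is
    therefore killed by every [chi]. *)
Lemma flat_free (K : choiceType) : flat ({freeg K / R} : lmodType R).
Proof.
apply: flatP => A B f inj_f; apply/inj0P => t ft.
have [D [injD cogD]] := ex_injective_cogenerator R.
apply: cogD => chi.
have ex_g (k : K) : exists g : {linear B -> D}, forall a, g (f a) = chi (tens a << k >>).
  exact: (injD _ _ f (compl chi (tensl A (<< k >> : {freeg K / R}))) inj_f).
have [g gE] := choice ex_g.
have [||h hE] := @tensor_univ R B {freeg K / R} D (fun b => free_lift (fun k => g k b)).
- move=> u a x y; elim/freeg_ind: u => [|c k u ih]; first by rewrite !linear0 ?scaler0 ?addr0.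
  have E (phi : K -> D) : free_lift phi (c *: << k >> + u) = c *: phi k + free_lift phi u.
    by rewrite linearP free_liftU.
  by rewrite !E ih linearP !scalerDr addrACA !scalerA [c * a]mulrC.
- by move=> b a x y; rewrite linearP.
have -> : chi t = h (tensor_map _ f t).
  apply: (tensor_ext (g := compl h (tensor_map _ f))) => a u /=.
  rewrite tensor_mapE hE.
  apply: (free_ext (f := compl chi (tensr _ a)) (g := free_lift _)) => k /=.
  by rewrite -[fglift _ _]/(free_lift _ _) free_liftU gE.
by rewrite ft linear0.
Qed.

Lemma ex_flat_cover M :
  exists (F K : lmodType R) (i : {linear K -> F}) (p : {linear F -> M}),
    flat F /\ short_exact i p.
Proof.
have [K [p sp]] := ex_free_cover M; have [L [i iP]] := ex_short_exact_epi sp.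
by exists {freeg K / R}, L, i, p; split=> //; apply: flat_free.
Qed.

Lemma projective_lift n M N (q : {linear M -> N}) (f : {linear 'rV[R]_n -> N}) :
  surj q -> exists h : {linear 'rV[R]_n -> M}, forall x, q (h x) = f x.
Proof.
move=> sq; have [m mE] := choice (fun i : 'I_n => sq (f (delta_mx 0 i))).
have lin_h : linear (fun u : 'rV[R]_n => \sum_i u 0 i *: m i).
  move=> a u v; rewrite scaler_sumr -big_split; apply: eq_bigr => i _.
  by rewrite !mxE scalerDl scalerA.
exists (linear_of lin_h) => x /=; rewrite {2}[x]row_sum_delta !linear_sum.
by apply: eq_bigr => i _; rewrite !linearZ /= mE.
Qed.

Lemma flat_rV n : flat ('rV[R]_n : lmodType R).
Proof.
have [K [p sp]] := ex_free_cover ('rV[R]_n : lmodType R).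
have [h hE] := projective_lift (idl 'rV[R]_n) sp.
exact: flat_retract hE (@flat_free K).
Qed.

Lemma flat_zero F : (forall x : F, x = 0) -> flat F.
Proof.
move=> F0; have [K [p sp]] := ex_free_cover F.
apply: (@flat_retract F {freeg K / R} (zerol _ _) p) => [x|]; last exact: flat_free.
by rewrite (F0 x) linear0.
Qed.

End Flat.

(** * Vanishing of Tor and flat dimension *)

Section ThreeByThree.
Variable R : comNzRingType.
Implicit Types A B C D M N X F P K J Z : lmodType R.

Lemma tensorr_right_exact M A B C (f : {linear A -> B}) (g : {linear B -> C})
    (f' : {linear tensor M A -> tensor M B}) (g' : {linear tensor M B -> tensor M C}) :
  exact_at f g -> surj g ->
  (forall m a, f' (tens m a) = tens m (f a)) ->
  (forall m b, g' (tens m b) = tens m (g b)) -> exact_at f' g' /\ surj g'.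
Proof.
move=> fg sg f'E g'E.
have sg' : surj g'.
  elim/tensor_ind => [|m c t [u <-]]; first by exists 0; rewrite linear0.
  by have [b <-] := sg c; exists (tens m b + u); rewrite linearD g'E.
split=> // t; split; last first.
  case=> u <-; elim/tensor_ind: u => [|m a u ih]; first by rewrite !linear0.
  by rewrite !linearD ih f'E g'E (exact0 _ fg) tens0r addr0.
have [s sE] := ex_tensor_swap M B; have [s' s'E] := ex_tensor_swap B M.
have [r rE] := ex_tensor_swap M C; have [q qE] := ex_tensor_swap A M.
have sg't : tensor_map M g (s t) = r (g' t).
  elim/tensor_ind: t => [|m b t ih]; first by rewrite !linear0.
  by rewrite !linearD /= ih g'E rE sE tensor_mapE.
have sK u : s' (s u) = u.
  elim/tensor_ind: u => [|m b u ih]; first by rewrite !linear0.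
  by rewrite !linearD /= ih sE s'E.
move=> g't; have [u uE] : exists u, tensor_map M f u = s t.
  by apply/(tensor_right_exact fg sg); rewrite /= sg't g't linear0.
exists (q u); rewrite -(sK t) -uE.
elim/tensor_ind: u {uE} => [|a m u ih]; first by rewrite !linear0.
by rewrite !linearD /= ih qE f'E tensor_mapE s'E.
Qed.

Section Chase.
Variables (K F Z J P N : lmodType R).
Variables (i : {linear K -> F}) (p : {linear F -> Z}).
Variables (j : {linear J -> P}) (q : {linear P -> N}).
Hypotheses (ip : exact_at i p) (sp : surj p) (jq : exact_at j q) (sq : surj q).

(** A snake in the 3x3 diagram of [K], [F], [Z] against [J], [P], [N]: an element killed in Z ⊗ P
    lifts to F ⊗ J, its image in F ⊗ P comes from K ⊗ P, and the class of that in K ⊗ N dies in F ⊗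
    N, hence is zero. *)
Lemma tensor_chase_up :
  injective (tensor_map F j) -> injective (tensor_map N i) ->
  injective (tensor_map Z j).
Proof.
have [jK jKE] := ex_tensor_mapr K j; have [qK qKE] := ex_tensor_mapr K q.
have [jF jFE] := ex_tensor_mapr F j; have [qF qFE] := ex_tensor_mapr F q.
have [jZ jZE] := ex_tensor_mapr Z j.
rewrite (tensor_map_swap_inj jFE) (tensor_map_swap_inj jZE) => ijF iiN.
have [jqK _] := tensorr_right_exact jq sq jKE qKE.
have [jqF _] := tensorr_right_exact jq sq jFE qFE.
have qi t : qF (tensor_map P i t) = tensor_map N i (qK t).
  elim/tensor_ind: t => [|k x t ih]; first by rewrite !linear0.
  by rewrite !linearD /= ih qKE !tensor_mapE qFE.
have ij t : tensor_map P i (jK t) = jF (tensor_map J i t).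
  elim/tensor_ind: t => [|k x t ih]; first by rewrite !linear0.
  by rewrite !linearD /= ih jKE !tensor_mapE jFE.
have pj t : tensor_map P p (jF t) = jZ (tensor_map J p t).
  elim/tensor_ind: t => [|k x t ih]; first by rewrite !linear0.
  by rewrite !linearD /= ih jFE !tensor_mapE jZE.
apply/inj0P => z jz.
have [f fz] := tensor_map_surj (N := J) sp z; rewrite -fz.
have [k kE] : exists k, tensor_map P i k = jF f.
  by apply/(tensor_right_exact ip sp); rewrite /= pj fz.
have [k' k'E] : exists k', jK k' = k.
  apply/jqK; apply: iiN; rewrite /= -qi kE linear0; exact: exact0.
have <- : tensor_map J i k' = f by apply: ijF; rewrite -ij k'E.
exact: (exact0 _ (tensor_right_exact ip sp)).
Qed.

(** The same zigzag run backwards, from K ⊗ N to Z ⊗ J. *)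
Lemma tensor_chase_down :
  injective (tensor_map Z j) -> injective (tensor_map P i) ->
  injective (tensor_map N i).
Proof.
have [jK jKE] := ex_tensor_mapr K j; have [qK qKE] := ex_tensor_mapr K q.
have [jF jFE] := ex_tensor_mapr F j; have [qF qFE] := ex_tensor_mapr F q.
have [jZ jZE] := ex_tensor_mapr Z j.
rewrite (tensor_map_swap_inj jZE) => ijZ iiP.
have [jqK sqK] := tensorr_right_exact jq sq jKE qKE.
have [jqF _] := tensorr_right_exact jq sq jFE qFE.
have qi t : qF (tensor_map P i t) = tensor_map N i (qK t).
  elim/tensor_ind: t => [|k x t ih]; first by rewrite !linear0.
  by rewrite !linearD /= ih qKE !tensor_mapE qFE.
have ij t : tensor_map P i (jK t) = jF (tensor_map J i t).
  elim/tensor_ind: t => [|k x t ih]; first by rewrite !linear0.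
  by rewrite !linearD /= ih jKE !tensor_mapE jFE.
have pj t : tensor_map P p (jF t) = jZ (tensor_map J p t).
  elim/tensor_ind: t => [|k x t ih]; first by rewrite !linear0.
  by rewrite !linearD /= ih jFE !tensor_mapE jZE.
apply/inj0P => n; have [k <-] := sqK n => /= ik.
have [f fE] : exists f, jF f = tensor_map P i k by apply/jqF; rewrite qi.
have [k' k'E] : exists k', tensor_map J i k' = f.
  apply/(tensor_right_exact ip sp); apply: ijZ; rewrite /= -pj fE linear0.
  exact: (exact0 _ (tensor_right_exact ip sp)).
have <- : jK k' = k by apply: iiP; rewrite /= ij k'E.
exact: exact0.
Qed.

End Chase.
End ThreeByThree.

Section Tor.
Variable R : comNzRingType.
Implicit Types A B C D E G M N X F P K J Z W : lmodType R.

(* Vanishing of Tor_1(M, N). *)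
Definition tor0 M N := forall K F (i : {linear K -> F}) (p : {linear F -> M}),
  flat F -> short_exact i p -> injective (tensor_map N i).

(** This one chase yields both the symmetry of Tor and its independence of the cover: a single good
    cover of [M] controls every flat cover of [N]. *)
Lemma tor0_coverC M N K F (i : {linear K -> F}) (p : {linear F -> M}) :
  flat F -> short_exact i p -> injective (tensor_map N i) -> tor0 N M.
Proof.
move=> flatF [_ ip sp] inj J P j q flatP [inj_j jq sq].
by apply: (tensor_chase_up ip sp jq sq) => //; apply: flat_inj.
Qed.

Lemma tor0C M N : tor0 M N -> tor0 N M.
Proof.
move=> MN; have [F [K [i [p [flatF ip]]]]] := ex_flat_cover M.
by apply: (tor0_coverC flatF ip); apply: (MN _ _ _ _ flatF ip).
Qed.

Lemma tor0_cover M N K F (i : {linear K -> F}) (p : {linear F -> M}) :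
  flat F -> short_exact i p -> injective (tensor_map N i) -> tor0 M N.
Proof. by move=> flatF ip inj; apply/tor0C/(tor0_coverC flatF ip). Qed.

Lemma tor0_inj M N A B (f : {linear A -> B}) (g : {linear B -> M}) :
  tor0 M N -> short_exact f g -> injective (tensor_map N f).
Proof.
move=> /tor0C MN [inj_f fg sg].
have [P [J [j [q [flatP jq]]]]] := ex_flat_cover N.
have inj_j := MN _ _ _ _ flatP jq; case: jq => _ jq sq.
by apply: (tensor_chase_down fg sg jq sq) => //; apply: flat_inj.
Qed.

Lemma flat_tor0 M F : flat F -> tor0 M F.
Proof. by move=> flatF K G i p _ [inj_i _ _]; apply: flat_inj. Qed.

Lemma tor0_flat F : (forall M, tor0 M F) -> flat F.
Proof.
move=> F0; apply: flatP => A B f /ex_short_exact_mono[M [g fg]].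
exact: tor0_inj (F0 M) fg.
Qed.

(* Tor_1(Z, E) = Tor_2(W, E) = Tor_1(W, J). *)
Lemma tor0_shift Z F W (i : {linear Z -> F}) (p : {linear F -> W})
    J P E (j : {linear J -> P}) (q : {linear P -> E}) :
  flat F -> short_exact i p -> flat P -> short_exact j q -> tor0 Z E -> tor0 W J.
Proof.
move=> flatF ip flatP jq /tor0C/(_ _ _ _ _ flatP jq) inj_j.
apply: (tor0_cover flatF ip); case: ip jq => inj_i _ _ [_ _ _].
have [jZ jZE] := ex_tensor_mapr Z j; have [jF jFE] := ex_tensor_mapr F j.
move: inj_j; rewrite (tensor_map_swap_inj jZE) => inj_jZ.
apply/inj0P => t it; apply: inj_jZ; rewrite linear0.
apply: (flat_inj0 flatP inj_i).
have -> : tensor_map P i (jZ t) = jF (tensor_map J i t).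
  elim/tensor_ind: t {it} => [|k x t ih]; first by rewrite !linear0.
  by rewrite !linearD /= ih jZE !tensor_mapE jFE.
by have -> : tensor_map J i t = 0 by []; rewrite linear0.
Qed.

Lemma tor0_shiftE Z F W (i : {linear Z -> F}) (p : {linear F -> W})
    J P E (j : {linear J -> P}) (q : {linear P -> E}) :
  flat F -> short_exact i p -> flat P -> short_exact j q -> tor0 Z E <-> tor0 W J.
Proof.
move=> flatF ip flatP jq; split; first exact: (tor0_shift flatF ip flatP jq).
by move=> /tor0C/(tor0_shift flatP jq flatF ip)/tor0C.
Qed.

Lemma tor0_retract M N N' (s : {linear N -> N'}) (r : {linear N' -> N}) :
  (forall x, r (s x) = x) -> tor0 M N' -> tor0 M N.
Proof.
move=> rK MN K F i p flatF ip; apply/inj0P => t it.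
have [sK sKE] := ex_tensor_mapr K s; have [rK' rKE] := ex_tensor_mapr K r.
have [sF sFE] := ex_tensor_mapr F s.
have <- : rK' (sK t) = t.
  elim/tensor_ind: t {it} => [|k x t ih]; first by rewrite !linear0.
  by rewrite !linearD /= ih sKE rKE rK.
have -> : sK t = 0; last exact: linear0.
apply: (MN _ _ _ _ flatF ip); rewrite linear0 /=.
have -> : tensor_map N' i (sK t) = sF (tensor_map N i t).
  elim/tensor_ind: t {it} => [|k x t ih]; first by rewrite !linear0.
  by rewrite !linearD /= ih sKE !tensor_mapE sFE.
by have -> : tensor_map N i t = 0 by []; rewrite linear0.
Qed.

(** Tor_1(Z, A) lies between Tor_2(Z, C) = 0 and Tor_1(Z, B). Concretely, flatness of [C] keeps K ⊗
    A -> K ⊗ B injective. *)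
Lemma tor0_subflat Z A B C (f : {linear A -> B}) (g : {linear B -> C}) :
  short_exact f g -> flat C -> tor0 Z B -> tor0 Z A.
Proof.
move=> fg flatC ZB K F i p flatF ip; apply/inj0P => t it.
have /tor0C KC : tor0 K C := flat_tor0 (M := K) flatC.
have inj_f := tor0_inj KC fg.
have [fK fKE] := ex_tensor_mapr K f; have [fF fFE] := ex_tensor_mapr F f.
move: inj_f; rewrite (tensor_map_swap_inj fKE) => inj_fK.
apply: inj_fK; rewrite linear0; apply: (ZB _ _ _ _ flatF ip); rewrite linear0 /=.
have -> : tensor_map B i (fK t) = fF (tensor_map A i t).
  elim/tensor_ind: t {it} => [|k x t ih]; first by rewrite !linear0.
  by rewrite !linearD /= ih fKE !tensor_mapE fFE.
by have -> : tensor_map A i t = 0 by []; rewrite linear0.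
Qed.

(** The long exact sequence puts Tor_1(M, J) between Tor_1(G, J) and the kernel of M1 ⊗ J -> G ⊗
    J. *)
Lemma tor0_quotient M1 G M (i : {linear M1 -> G}) (p : {linear G -> M}) J :
  short_exact i p -> tor0 G J -> injective (tensor_map J i) -> tor0 M J.
Proof.
move=> [_ ip sp] /tor0C GJ inj_i.
have [P [J' [j [q [flatP jq]]]]] := ex_flat_cover J.
apply/tor0C/(tor0_cover flatP jq); have inj_j := GJ _ _ _ _ flatP jq.
by case: jq => _ jq sq; apply: (tensor_chase_up ip sp jq sq).
Qed.

(** A relation allowing arbitrary flat covers, so that finite free covers over S and their
    reductions modulo x both qualify. *)
Inductive syzygy (W : lmodType R) : nat -> lmodType R -> Prop :=
| syzygy0 : syzygy W 0 W
| syzygyS n Z K F (i : {linear K -> F}) (p : {linear F -> Z}) :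
    syzygy W n Z -> flat F -> short_exact i p -> syzygy W n.+1 K.

Lemma syzygyE W n K : syzygy W n K ->
  if n is m.+1 then
    exists Z F (i : {linear K -> F}) (p : {linear F -> Z}),
      [/\ syzygy W m Z, flat F & short_exact i p]
  else K = W.
Proof. by case=> // m Z K' F i p WZ flatF ip; exists Z, F, i, p. Qed.

Lemma syzygy_front W n K : syzygy W n.+1 K ->
  exists Z F (i : {linear Z -> F}) (p : {linear F -> W}),
    [/\ flat F, short_exact i p & syzygy Z n K].
Proof.
elim: n K => [|n ih] K /syzygyE[Z [F [i [p [WZ flatF ip]]]]].
  have ZW := syzygyE WZ; rewrite /= in ZW; rewrite ZW in p ip *.
  by exists K, F, i, p; split=> //; apply: syzygy0.
have [Z' [F' [i' [p' [flatF' ip' Z'Z]]]]] := ih _ WZ.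
by exists Z', F', i', p'; split=> //; apply: (syzygyS Z'Z flatF ip).
Qed.

Lemma ex_syzygy W n : exists K, syzygy W n K.
Proof.
elim: n => [|n [K WK]]; first by exists W; apply: syzygy0.
have [F [L [i [p [flatF ip]]]]] := ex_flat_cover K.
by exists L; apply: (syzygyS WK flatF ip).
Qed.

(** Both sides express the vanishing of Tor_{n+1}(W, E). Each shift removes the last cover on the
    side of [W] and the first one on the side of [E], whence [syzygy_front]. *)
Lemma tor0_syzygy W E n Z J : syzygy W n Z -> syzygy E n J ->
  tor0 Z E <-> tor0 W J.
Proof.
elim: n E Z J => [|n ih] E Z J; first by move=> /syzygyE -> /syzygyE ->.
move=> /syzygyE[Z' [F [i [p [WZ' flatF ip]]]]].
move=> /syzygy_front[J' [P [j [q [flatP jq J'J]]]]].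
by rewrite (tor0_shiftE flatF ip flatP jq) (ih _ _ _ WZ' J'J).
Qed.

(* The flat dimension of N is at most n: Tor_{n+1}(-, N) vanishes. *)
Definition fdle n N := forall W Z, syzygy W n Z -> tor0 Z N.

Lemma fdle0 N : fdle 0 N <-> flat N.
Proof.
split=> [N0|flatN W Z _]; last exact: flat_tor0.
by apply: tor0_flat => M; apply: N0 (syzygy0 M).
Qed.

Lemma fdleS n K F E (i : {linear K -> F}) (p : {linear F -> E}) :
  flat F -> short_exact i p -> fdle n K <-> fdle n.+1 E.
Proof.
move=> flatF ip; split=> [Kn W Z|En W Z WZ].
  move=> /syzygyE[Z' [G [j [q [WZ' flatG jq]]]]].
  by apply/(tor0_shiftE flatG jq flatF ip)/Kn/WZ'.
have [G [L [j [q [flatG jq]]]]] := ex_flat_cover Z.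
by apply/(tor0_shiftE flatG jq flatF ip)/En/(syzygyS WZ flatG jq).
Qed.

Lemma fdle_syzygy n E J : syzygy E n J -> flat J <-> fdle n E.
Proof.
elim: n E J => [|n ih] E J; first by move=> /syzygyE ->; rewrite fdle0.
move=> /syzygy_front[J' [P [j [q [flatP jq J'J]]]]].
by rewrite -(fdleS _ flatP jq); apply: ih.
Qed.

End Tor.

(** * Gorenstein flat dimension and injective modules *)

Section Gorenstein.
Variable R : comNzRingType.
Implicit Types A B C D E G M N X F P K J Z W I L : lmodType R.

Lemma exact_splice A A' B C C' (p : {linear A -> A'}) (i : {linear A' -> B})
    (q : {linear B -> C}) (j : {linear C -> C'})
    (f : {linear A -> B}) (g : {linear B -> C'}) :
  surj p -> exact_at i q -> injective j ->
  (forall x, f x = i (p x)) -> (forall y, g y = j (q y)) -> exact_at f g.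
Proof.
move=> sp iq inj_j fE gE y; rewrite gE; split=> [jq|[x <-]].
  have /iq[x <-] : q y = 0 by apply: inj_j; rewrite jq linear0.
  by have [z <-] := sp x; exists z.
by rewrite fE (exact0 _ iq) linear0.
Qed.

(** [Z] is the image of [d i]. For [k = 0], exactness after tensoring with [I] says that the kernel
    of the cover F i -> Z stays embedded. To raise [k], [Z] is replaced by the preceding image and
    [J] by the preceding syzygy of [I]. *)
Lemma syzygy_tor0_complex (F : int -> lmodType R) (d : forall i, {linear F i -> F (i - 1)}) I :
  (forall i, flat (F i)) -> (forall i, exact_at (d i) (d (i - 1))) ->
  (forall i, exact_at (tensor_map I (d i)) (tensor_map I (d (i - 1)))) ->
  forall k i Z (p : {linear F i -> Z}) (j : {linear Z -> F (i - 1)}),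
    surj p -> injective j -> (forall x, j (p x) = d i x) ->
  forall J, syzygy I k J -> tor0 Z J.
Proof.
move=> flatF exd exdI k i.
pose T k i := forall Z (p : {linear F i -> Z}) (j : {linear Z -> F (i - 1)}),
  surj p -> injective j -> (forall x, j (p x) = d i x) ->
  forall J, syzygy I k J -> tor0 Z J.
suff: T k i by [].
(* With [i] written as [m - 1 - 1], the two preceding differentials [d m] and [d (m - 1)] compose
   without casts. *)
elim: k i => [|k ih] i; have -> : i = i + 1 + 1 - 1 - 1 by rewrite !addrK.
all: move: (i + 1 + 1) => {i} m Z p j sp inj_j jp J.
  move=> /syzygyE ->.
  have [K [q [l [sq inj_l lq]]]] := ex_image (d (m - 1)).
  have lp : short_exact l p.
    split=> // y; split=> [py|[x <-]].
      have /exd[x <-] : d (m - 1 - 1) y = 0 by rewrite -jp py linear0.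
      by exists (q x); rewrite lq.
    have [z <-] := sq x; apply: inj_j; rewrite jp lq linear0; exact: (exact0 _ (exd _)).
  apply: (tor0_cover (flatF _) lp); apply/inj0P => t.
  have [u <-] := tensor_map_surj (N := I) sq t.
  rewrite [X in X = 0 -> _](tensor_map_comp lq) => /exdI[v <-].
  rewrite [LHS](_ : _ = tensor_map I (zerol _ _) v); last first.
    apply: tensor_map_comp => x; apply: inj_l.
    rewrite lq linear0; exact: (exact0 _ (exd _)).
  elim/tensor_ind: v => [|a n v vE]; first by rewrite linear0.
  by rewrite linearD /= vE tensor_mapE tens0l addr0.
move=> /syzygyE[J' [P [j' [q' [IJ' flatP jq']]]]].
have [K [q [l [sq inj_l lq]]]] := ex_image (d (m - 1)).
have lp : short_exact l p.
  split=> // y; split=> [py|[x <-]].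
    have /exd[x <-] : d (m - 1 - 1) y = 0 by rewrite -jp py linear0.
    by exists (q x); rewrite lq.
  have [z <-] := sq x; apply: inj_j; rewrite jp lq linear0; exact: (exact0 _ (exd _)).
apply: (tor0_shift (flatF _) lp flatP jq'); exact: (ih _ _ q l).
Qed.

Lemma gorenstein_flat_tor0 G I k J :
  gorenstein_flat G -> injective_module I -> syzygy I k J -> tor0 G J.
Proof.
move=> [F [d [j [flatF exd exdI inj_j jP]]]] injI.
have [|p pP] := @factor_mono _ _ _ _ j (d 0) inj_j; first by move=> x; apply/jP; exists x.
apply: (syzygy_tor0_complex flatF exd (exdI _ injI) (p := p) (j := j)) => // z.
have [x xz] : exists x, d 0 x = j z by apply/jP; exists z.
by exists x; apply: inj_j; rewrite pP.
Qed.

(** Dimension shifting along the resolution, whose terms have no higher Tor with [I]; the conclusion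
    is Tor_{k+1}(M, I) = 0. *)
Lemma gorenstein_resolution_tor0 M n k I J : gorenstein_flat_resolution M n ->
  injective_module I -> (n <= k)%N -> syzygy I k J -> tor0 M J.
Proof.
move=> + injI; elim: n k M J => [|n ih] k M J [G [g [e [gfG G0 se ge exg]]]] nk IJ.
  have g0 : short_exact (g 0%N) e.
    by split=> // x y _; rewrite (G0 1%N isT x) (G0 1%N isT y).
  apply: (tor0_quotient g0); first exact: (gorenstein_flat_tor0 (gfG 0%N isT) injI IJ).
  apply/inj0P => + _; elim/tensor_ind => // a x t ->.
  by rewrite (G0 1%N isT a) tens0l addr0.
have [L [i iP]] := ex_kernel e; have [inj_i ie] := iP.
have [|e' e'E] := @factor_mono _ _ _ _ i (g 0%N) inj_i.
  by move=> x; apply/ie; apply: exact0 ge.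
have gfrL : gorenstein_flat_resolution L n.
  exists (fun k => G k.+1), (fun k => g k.+1), e'; split=> //.
  - by move=> l ln; apply: gfG.
  - by move=> l nl; apply: G0.
  - move=> l; have [x xl] : exists x, g 0%N x = i l by apply/ge; apply: exact0 ie.
    by exists x; apply: inj_i; rewrite e'E.
  - move=> x; rewrite -exg -e'E; split=> [->|ex]; first by rewrite linear0.
    by apply: inj_i; rewrite ex linear0.
have ieS : short_exact i e by [].
apply: (tor0_quotient ieS); first exact: (gorenstein_flat_tor0 (gfG 0%N isT) injI IJ).
(* L ⊗ J embeds in L ⊗ P because Tor_1(L, J') = 0, and L ⊗ P embeds in G 0 ⊗ P because [P] is flat;
   so L ⊗ J -> G 0 ⊗ J is injective. *)
case: k nk IJ => // k nk /syzygyE[J' [P [j [q [IJ' flatP jq]]]]].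
have /tor0C/(_ _ _ _ _ flatP jq) := ih _ _ _ gfrL nk IJ'.
have [jL jLE] := ex_tensor_mapr L j; have [jG jGE] := ex_tensor_mapr (G 0%N) j.
rewrite (tensor_map_swap_inj jLE) => inj_jL; apply/inj0P => t it.
apply: inj_jL; rewrite linear0; apply: (flat_inj0 flatP inj_i).
have -> : tensor_map P i (jL t) = jG (tensor_map J i t).
  elim/tensor_ind: t {it} => [|l x t iht]; first by rewrite !linear0.
  by rewrite !linearD /= iht jLE !tensor_mapE jGE.
by have -> : tensor_map J i t = 0 by []; rewrite linear0.
Qed.

Lemma gorenstein_resolution_fdle n :
  (forall M, exists2 m, (m <= n)%N & gorenstein_flat_resolution M m) ->
  forall I, injective_module I -> fdle n I.
Proof.
move=> gfr I injI W Z WZ; have [J IJ] := ex_syzygy I n.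
have [m mn gfrW] := gfr W.
by apply/(tor0_syzygy WZ IJ); apply: (gorenstein_resolution_tor0 gfrW injI mn IJ).
Qed.

(** * Gluing N-th syzygies into totally acyclic complexes *)

Section InjectivesOfFiniteFlatDimension.
Variable N : nat.
Hypothesis fdI : forall I, injective_module I -> fdle N I.

(* Horseshoe: the n-th syzygies of W -> E -> E / W, with E injective. *)
Lemma syzygy_horseshoe n W K : (n <= N)%N -> syzygy W n K ->
  exists E C (i : {linear K -> E}) (p : {linear E -> C}),
    [/\ short_exact i p, exists W', syzygy W' n C & fdle (N - n) E].
Proof.
elim: n K => [|n ih] K nN.
  move=> /syzygyE ->; have [E [i [injE inj_i]]] := ex_injective_embedding W.
  have [C [p ip]] := ex_short_exact_mono inj_i.
  exists E, C, i, p; split=> //; last by rewrite subn0; apply: fdI.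
  by exists C; apply: syzygy0.
move=> /syzygyE[L [P [i [p [WL flatP [inj_i ip sp]]]]]].
have [E [C [f [g [[inj_f fg sg] [W' W'C] fdE]]]]] := ih L (ltnW nN) WL.
(* A flat cover of [C] need not lift to [E], so the cover of [C] is taken to be the composite of a
   cover [Q] of [E] with [g]; then [P * Q] covers [E] compatibly with both ends. *)
have [Q [_ [_ [h [flatQ [_ _ sh]]]]]] := ex_flat_cover E.
have sphi : surj (addl (compl f p) h).
  by move=> y; have [x <-] := sh y; exists (0, x); rewrite /= !linear0 add0r.
have [KE [e eS]] := ex_short_exact_epi sphi.
have sgh : surj (compl g h).
  by move=> y; have [z <-] := sg y; have [x <-] := sh z; exists x.
have [KC [c cS]] := ex_short_exact_epi sgh.
have [inj_e ee _] := eS; have [inj_c ec _] := cS.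
have [|a aE] := @factor_mono _ _ _ _ e (compl (inll P Q) i) inj_e.
  by move=> x; apply/ee; rewrite /= (exact0 _ ip) !linear0 addr0.
have [|b bE] := @factor_mono _ _ _ _ c (compl (sndl P Q) e) inj_c.
  move=> x; apply/ec; rewrite /=.
  have := exact0 x ee; rewrite /= => /eqP; rewrite addrC addr_eq0 => /eqP ->.
  by rewrite linearN (exact0 _ fg) oppr0.
exists KE, KC, a, b; split; last 2 first.
- by exists W'; apply: (syzygyS W'C flatQ cS).
- apply/(fdleS _ (flat_prod flatP flatQ) eS); by rewrite subnSK.
split.
- apply/inj0P => x ax; apply: inj_i; rewrite linear0.
  by have := aE x; rewrite ax linear0 => /pair_equal_spec[].
- move=> y; split=> [by0|[x <-]]; last first.
    by apply: inj_c; rewrite bE /= aE linear0.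
  have e2 : (e y).2 = 0 by have := bE y; rewrite by0 linear0 => /esym.
  have /ip[x xE] : p (e y).1 = 0.
    apply: inj_f; rewrite linear0; have := exact0 y ee.
    by rewrite /= e2 linear0 addr0.
  exists x; apply: inj_e; rewrite aE /= xE; case: (e y) e2 => u v /= -> //.
- move=> k; have /fg[l lE] : g (h (c k)) = 0 := exact0 k ec.
  have [x xl] := sp l.
  have [y yE] : exists y, e y = (- x, c k).
    by apply/ee; rewrite /= !linearN xl lE addNr.
  by exists y; apply: inj_c; rewrite bE /= yE.
Qed.

Definition syzygy_module Z := exists W, syzygy W N Z.

Definition splice A B := exists F (i : {linear A -> F}) (p : {linear F -> B}),
  flat F /\ short_exact i p.

(** At [n = N] the middle term of the horseshoe is an N-th syzygy of an injective module, hence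
    flat, and the cokernel is again an N-th syzygy. *)
Lemma splice_right A : syzygy_module A -> exists B, syzygy_module B /\ splice A B.
Proof.
move=> [W WA]; have [F [B [i [p [ip BW]]]]] := syzygy_horseshoe (leqnn N) WA.
by rewrite subnn => /fdle0 flatF; exists B; split=> //; exists F, i, p.
Qed.

(** One more cover gives an (N+1)-st syzygy of [W], which is an N-th syzygy of a first syzygy of
    [W]. *)
Lemma splice_left B : syzygy_module B -> exists A, syzygy_module A /\ splice A B.
Proof.
move=> [W WB]; have [F [A [i [p [flatF ip]]]]] := ex_flat_cover B.
exists A; split; last by exists F, i, p.
by have [W' [_ [_ [_ [_ _ ?]]]]] := syzygy_front (syzygyS WB flatF ip); exists W'.
Qed.

Lemma syzygy_gorenstein_flat M : syzygy_module M -> gorenstein_flat M.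
Proof.
move=> MN; pose T := {Z | syzygy_module Z}.
have [lf lfP] : {f : T -> T & forall B : T, splice (sval (f B)) (sval B)}.
  apply: (@choice T T (fun B A : T => splice (sval A) (sval B))) => -[B BN] /=.
  by have [A [AN AB]] := splice_left BN; exists (exist _ A AN).
have [rt rtP] : {f : T -> T & forall A : T, splice (sval A) (sval (f A))}.
  apply: (@choice T T (fun A B : T => splice (sval A) (sval B))) => -[A AN] /=.
  by have [B [BN AB]] := splice_right AN; exists (exist _ B BN).
pose M0 : T := exist _ M MN.
(* [M] is put at index -1, which is [Negz 0], since it must be the image of [d 0] in [F (0 - 1)]. *)
pose Z (i : int) : lmodType R :=
  sval (match i with Posz n => iter n.+1 lf M0 | Negz n => iter n rt M0 end).
have ZN i : syzygy_module (Z i) by rewrite /Z; apply: svalP.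
have ZP i : splice (Z i) (Z (i - 1)).
  case: i => [[|n]|n].
  - exact: (lfP M0).
  - by rewrite (_ : n.+1%:Z - 1 = n%:Z) ?[Z n.+1]/(sval (lf _)) //; [apply: lfP|rewrite -addn1 PoszD addrK].
  - rewrite (_ : Negz n - 1 = Negz n.+1); first exact: rtP.
    by rewrite !NegzE -opprD -[in RHS]addn1 PoszD.
pose F i := sval (cid (ZP i)).
have FP i := svalP (cid (ZP i)).
pose a i : {linear Z i -> F i} := sval (cid (FP i)).
have aP i := svalP (cid (FP i)).
pose p i : {linear F i -> Z (i - 1)} := sval (cid (aP i)).
have pP i : flat (F i) /\ short_exact (a i) (p i) := svalP (cid (aP i)).
exists F, (fun i => compl (a (i - 1)) (p i)), (a (0 - 1)).
have sp i : surj (p i) by case: (pP i) => _ [].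
have inja i : injective (a i) by case: (pP i) => _ [].
have ap i : exact_at (a i) (p i) by case: (pP i) => _ [].
split=> [i|i|I injI i||y].
- by case: (pP i).
- exact: (exact_splice (sp i) (ap (i - 1)) (inja (i - 1 - 1))).
- apply: (exact_splice (p := tensor_map I (p i)) (i := tensor_map I (a (i - 1)))
    (q := tensor_map I (p (i - 1))) (j := tensor_map I (a (i - 1 - 1)))).
  + exact: tensor_map_surj.
  + exact: tensor_right_exact.
  (* The cokernel of this inclusion is an N-th syzygy, so its Tor_1 with [I] vanishes and the
     inclusion survives tensoring. *)
  + have [W WZ] := ZN (i - 1 - 1 - 1).
    exact: (tor0_inj (fdI injI WZ) (pP (i - 1 - 1)).2).
  + by move=> x; rewrite /= (tensor_map_comp (h := compl (a (i - 1)) (p i))).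
  + by move=> x; rewrite /= (tensor_map_comp (h := compl (a (i - 1 - 1)) (p (i - 1)))).
- exact: inja.
- split=> [[m <-]|[x <-]]; last by exists (p 0 x).
  by have [x <-] := sp 0 m; exists x.
Qed.

(** [F] is an N-th syzygy of the zero module, or of itself when N = 0. *)
Lemma flat_gorenstein_flat F : flat F -> gorenstein_flat F.
Proof.
move=> flatF; apply: syzygy_gorenstein_flat.
have [Z0 Z00] := ex_zero_module R.
have Z0n n : syzygy Z0 n Z0.
  elim: n => [|n ih]; first exact: syzygy0.
  apply: (@syzygyS _ _ _ _ _ _ (zerol Z0 Z0) (zerol Z0 Z0) ih (flat_zero Z00)).
  by split=> [x y _|y|y]; [rewrite (Z00 x) (Z00 y)|split=> // _; exists 0; rewrite (Z00 y)|exists 0].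
rewrite /syzygy_module; case: N => [|n]; first by exists F; apply: syzygy0.
exists Z0; apply: (@syzygyS _ _ _ _ _ _ (idl F) (zerol F Z0) (Z0n n) flatF).
by split=> [//|y|y]; [split=> // _; exists y|exists 0; rewrite (Z00 y) linear0].
Qed.

Lemma syzygy_resolution M n K : syzygy M n K -> gorenstein_flat K ->
  gorenstein_flat_resolution M n.
Proof.
move=> MK gfK; have [Z0 Z00] := ex_zero_module R.
elim: n M MK => [|n ih] M.
  move=> /syzygyE KM; rewrite KM in gfK.
  exists (fun i => if i is 0%N then M else Z0), (fun i => zerol Z0 _), (idl M).
  split=> [[]//|[//|i] _ x|y|y|i y]; first exact: Z00.
  - by exists y.
  - by split=> [/= ->|[x <-] //]; exists 0.
  - by case: i y => [|i] y /=; split=> // _; exists 0; rewrite [RHS]Z00.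
move=> /syzygy_front[L [F [i [p [flatF [inj_i ip sp] LK]]]]].
have [G [g [e [gfG G0 se ge exg]]]] := ih L LK.
pose G' k := if k is l.+1 then G l else F.
pose g' k : {linear G' k.+1 -> G' k} :=
  if k is l.+1 return {linear G' k.+1 -> G' k} then g l else compl i e.
exists G', g', p; split=> [[|k] kn|[//|k] nk|//|y|[|k]] /=.
- exact: flat_gorenstein_flat.
- exact: gfG.
- exact: G0.
- rewrite ip; split=> [[x <-]|[x <-]]; last by exists (e x).
  by have [z <-] := se x; exists z.
- move=> y /=; rewrite -ge; split=> [iy|->]; last by rewrite linear0.
  by apply: inj_i; rewrite iy linear0.
- exact: exg.
Qed.

Lemma fdle_gorenstein_resolution M : gorenstein_flat_resolution M N.
Proof.
have [K MK] := ex_syzygy M N.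
by apply: (syzygy_resolution MK); apply: syzygy_gorenstein_flat; exists M.
Qed.

End InjectivesOfFiniteFlatDimension.

Lemma Gwdim_leP n : enat_le (Gwdim R) (Some n) <->
  (forall I, injective_module I -> fdle n I).
Proof.
rewrite (esupP _ (Some n)); split=> [le_n|fdI _ [M ->]].
  apply: gorenstein_resolution_fdle => M.
  have := le_n _ (ex_intro _ M erefl).
  have := (leastP (gorenstein_flat_resolution M) (Gfd M)).1 erefl.
  by case: (Gfd M) => // m [Mm _] /= mn; exists m.
have Mn := fdle_gorenstein_resolution fdI M.
have := (leastP (gorenstein_flat_resolution M) (Gfd M)).1 erefl.
by case: (Gfd M) => [m [_]|/(_ n)] /=; [apply|].
Qed.

End Gorenstein.

(** * Flatness and finitely generated ideals *)

Section FlatnessTest.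
Variable R : comNzRingType.
Implicit Types A B C D E M N X F P K J Z W I H : lmodType R.

Lemma tensor_fg A E (t : tensor A E) :
  exists n (h : {linear 'rV[R]_n -> A}) (u : tensor 'rV[R]_n E), tensor_map E h u = t.
Proof.
elim/tensor_ind: t => [|a e t [n [h [u <-]]]].
  by exists 0%N, (zerol _ _), 0; rewrite linear0.
have lin_k : linear (fun v : 'rV[R]_(1 + n) => lsubmx v 0 0 *: a + h (rsubmx v)).
  by move=> c v w; rewrite [rsubmx _]linearP [h _]linearP !mxE scalerDl scalerDr scalerA addrACA.
have lin_r : linear (fun v : 'rV[R]_n => row_mx (0 : 'rV[R]_1) v).
  by move=> c v w; rewrite scale_row_mx add_row_mx scaler0 addr0.
exists (1 + n)%N, (linear_of lin_k).
exists (tens (row_mx (const_mx 1) 0 : 'rV[R]_(1 + n)) e + tensor_map E (linear_of lin_r) u).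
rewrite linearD /= tensor_mapE /= row_mxKl row_mxKr mxE linear0 scale1r addr0.
congr (_ + _); rewrite (tensor_map_comp (h := h)) // => v /=.
by rewrite row_mxKl row_mxKr mxE scale0r add0r.
Qed.

(** Lambek's duality: with [D] an injective cogenerator, the test on ideals gives Baer's condition
    for [H] = Hom(E, D), and injectivity of [H] extends every functional on A ⊗ E to B ⊗ E. Finitely
    generated ideals suffice because an element of K ⊗ E involves only finitely many elements of
    [K]. *)
Lemma flat_fg_ideals E :
  (forall n (f : {linear 'rV[R]_n -> R^o}) C (q : {linear R^o -> C}),
    exact_at f q -> surj q -> tor0 C E) -> flat E.
Proof.
move=> idealE.
have inj_ideal K (j : {linear K -> R^o}) : injective j -> injective (tensor_map E j).
  move=> inj_j; apply/inj0P => t jt.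
  have [n [h [u ut]]] := tensor_fg t; rewrite -{}ut in jt *.
  have [L [p [i [sp inj_i ip]]]] := ex_image h.
  have inj_ji : injective (compl j i) by move=> x y /inj_j/inj_i.
  have [C [q [_ jiq sq]]] := ex_short_exact_mono inj_ji.
  have [C' [q' [jhq' sq']]] := ex_cokernel (compl j h).
  have jiq' : short_exact (compl j i) q'.
    split=> // y; rewrite jhq'; split=> [[x <-]|[x <-]].
      by exists (p x); rewrite /= ip.
    by have [z <-] := sp x; exists z; rewrite /= ip.
  have := tor0_inj (idealE _ _ _ _ jhq' sq') jiq'.
  move=> /inj0P/(_ (tensor_map E p u)).
  rewrite -(tensor_map_comp ip) => -> //; first by rewrite linear0.
  rewrite /= -(tensor_map_comp (g := j) (f := i) (h := compl j i)) //.
  by rewrite (tensor_map_comp ip).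
have [D [injD cogD]] := ex_injective_cogenerator R.
have [||H [io [inj_io ioP]]] := @ex_submod R (E -> D) (fun f => linear f).
- by move=> a x y; rewrite scaler0 addr0.
- by move=> c f g lf lg a x y; rewrite !fctE lf lg !scalerDr !scalerA mulrC addrACA.
have io_lin h : linear (io h) by apply/ioP; exists h.
have ex_h (f : {linear E -> D}) : exists h, forall e, io h e = f e.
  by have [h hf] := (ioP _).1 (fun a x y => linearP f a x y : f _ = _); exists h; rewrite hf.
have injH : injective_module H.
  apply: baer_injective => J g J0 JP gP.
  have [//||K [j [inj_j jP]]] := @ex_submod R R^o J; first by move=> a x y; apply: JP.
  have jJ x : J (j x) by apply/jP; exists x.
  have [||gE gEE] := @tensor_univ R K E D (fun x e => io (g (j x)) e).
  - by move=> e a x y; rewrite linearP gP // linearP !fctE.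
  - by move=> x; apply: io_lin.
  have [k kE] := injD _ _ (tensor_map E j) gE (inj_ideal _ _ inj_j).
  have [d dE] := ex_h (compl k (tensr E (1 : R^o))).
  exists d => r /jP[x <-]; apply: inj_io; apply/funext => e.
  rewrite linearZ [RHS]/(_ *: io d e) dE /= -gEE -kE /= tensor_mapE.
  have -> : tens (j x) e = (j x : R) *: tens (1 : R^o) e by rewrite -tensZl [_ *: _]mulr1.
  by rewrite linearZ.
apply: flatP => A B f inj_f; apply/inj0P => t ft; apply: cogD => chi.
have ex_hA a : exists h, forall e, io h e = chi (tens a e) := ex_h (compl chi (tensr E a)).
have [||hA hAE] := @ex_linear R A H (fun a h => forall e, io h e = chi (tens a e)) ex_hA.
- by move=> a h h' hE h'E; apply: inj_io; apply/funext => e; rewrite hE h'E.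
- by move=> c a a' h h' hE h'E e; rewrite linearP !fctE tensDl tensZl linearP hE h'E.
have [hB hBE] := injH _ _ f hA inj_f.
have [||k kE] := @tensor_univ R B E D (fun b e => io (hB b) e).
- by move=> e a x y; rewrite !linearP !fctE.
- by move=> b; apply: io_lin.
have -> : chi t = k (tensor_map E f t).
  elim/tensor_ind: t {ft} => [|a e t ih]; first by rewrite !linear0.
  by rewrite !linearD /= ih tensor_mapE kE hBE hAE.
by have -> : tensor_map E f t = 0 by []; rewrite linear0.
Qed.

End FlatnessTest.

(** * Reduction modulo a regular element *)

(** Restriction of scalars, as an alias so that one group carries both module structures. *)
Definition restr (S R : comNzRingType) (phi : {rmorphism S -> R}) (M : lmodType R) :
  Type := M.

Section Restriction.
Variables (S R : comNzRingType) (phi : {rmorphism S -> R}) (M : lmodType R).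

Local Notation restr := (restr phi M).
HB.instance Definition _ := GRing.Zmodule.on restr.
Definition restr_scale (a : S) (m : restr) : restr := phi a *: (m : M).
Fact restr_scaleA a b m : restr_scale a (restr_scale b m) = restr_scale (a * b) m.
Proof. by rewrite /restr_scale scalerA rmorphM. Qed.
Fact restr_scale1 : left_id 1 restr_scale.
Proof. by move=> m; rewrite /restr_scale rmorph1 scale1r. Qed.
Fact restr_scaleDr : right_distributive restr_scale +%R.
Proof. by move=> a m m'; rewrite /restr_scale scalerDr. Qed.
Fact restr_scaleDl m : {morph restr_scale^~ m : a b / a + b}.
Proof. by move=> a b; rewrite /restr_scale rmorphD scalerDl. Qed.
HB.instance Definition _ := GRing.Zmodule_isLmodule.Build S restr
  restr_scaleA restr_scale1 restr_scaleDr restr_scaleDl.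

Lemma restrZ (a : S) (m : restr) : a *: m = phi a *: (m : M) :> M.
Proof. by []. Qed.

End Restriction.

Section RestrictionMap.
Variables (S R : comNzRingType) (phi : {rmorphism S -> R}) (A B : lmodType R).
Fact restr_map_linear (f : {linear A -> B}) : linear (f : restr phi A -> restr phi B).
Proof. by move=> a x y; rewrite restrZ (linearP f). Qed.
Definition restr_map f := linear_of (restr_map_linear f).
End RestrictionMap.

(* S stands for R[[x]], eps for evaluation at 0 and iota for constants. *)
Section RegularElement.
Variables (S R : comNzRingType) (eps : {rmorphism S -> R}) (iota : {rmorphism R -> S}).
Variable x : S.
Hypotheses (iotaK : forall r, eps (iota r) = r) (eps_x : eps x = 0).
Hypothesis eps_ker : forall a, eps a = 0 -> exists b, a = x * b.
Hypothesis x_reg : forall a, x * a = 0 -> a = 0.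

Implicit Types (A B N : lmodType R) (M E F K P Q : lmodType S).

(** [p] identifies [N] with M / xM, viewed over R; likewise [torsion] identifies [A] with (0 :_E
    x). *)
Definition reduction M N (p : {linear M -> restr eps N}) :=
  surj p /\ forall m, p m = 0 <-> exists m', m = x *: m'.

Definition torsion E A (k : {linear restr eps A -> E}) :=
  injective k /\ forall e, x *: e = 0 <-> exists a, k a = e.

Definition torsion_free M := forall m : M, x *: m = 0 -> m = 0.

(** [a - iota (eps a)] is a multiple of [x]. Through [iota], quotients and submodules killed by [x]
    thus become R-modules whose restriction along [eps] is the original structure. *)
Lemma scale_iota_eps M (m : M) a : (forall b : S, (x * b) *: m = 0) -> a *: m = iota (eps a) *: m.
Proof.
move=> xm; apply/eqP; rewrite -subr_eq0 -scalerBl.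
by have [|b ->] := @eps_ker (a - iota (eps a)); rewrite ?rmorphB /= ?iotaK ?subrr ?xm.
Qed.

Lemma ex_reduction M : exists N (p : {linear M -> restr eps N}), reduction p.
Proof.
have [C [q [qx sq]]] := ex_cokernel (scalel M x).
have lin_q : linear (q : M -> restr eps (restr iota C)).
  move=> a m m'; rewrite linearP restrZ restrZ; congr (_ + _).
  refine (@scale_iota_eps C (q m) a _) => b.
  have <- : q (x *: (b *: m)) = 0 by apply/qx; exists (b *: m).
  by rewrite scalerA linearZ.
exists (restr iota C), (linear_of lin_q); split=> // m; split.
  by move=> /qx[m' <-]; exists m'.
by move=> [m' ->]; apply/qx; exists m'.
Qed.

Lemma ex_torsion E : exists A (k : {linear restr eps A -> E}), torsion k.
Proof.
have [K [i [inj_i ix]]] := ex_kernel (scalel E x).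
have lin_i : linear (i : restr eps (restr iota K) -> E).
  move=> a m m'; rewrite -linearP; congr (i (_ + m')).
  refine (esym (@scale_iota_eps K m a _)) => b.
  have xim : x *: i m = 0 by apply/ix; exists m.
  by apply: inj_i; rewrite linear0 linearZ /= mulrC -scalerA xim scaler0.
exists (restr iota K), (linear_of lin_i); split=> //.
Qed.

Lemma iotaE A (a : A) r : r *: a = iota r *: (a : restr eps A) :> A.
Proof. by rewrite restrZ iotaK. Qed.

Lemma ex_reduction_map M N M' N' (p : {linear M -> restr eps N})
    (p' : {linear M' -> restr eps N'}) (f : {linear M -> M'}) :
  reduction p -> reduction p' ->
  exists g : {linear N -> N'}, forall m, g (p m) = p' (f m).
Proof.
move=> [sp px] [sp' p'x].
have eqP' m m' : p m = p m' -> p' (f m) = p' (f m').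
  move=> e; have /px[n nE] : p (m - m') = 0 by rewrite linearB e subrr.
  apply/eqP; rewrite -subr_eq0 -!linearB nE linearZ; apply/eqP/p'x.
  by exists (f n).
have [||| g gP] := @ex_linear R N N' (fun n n' => exists2 m, p m = n & p' (f m) = n').
- by move=> n; have [m mn] := sp n; exists (p' (f m)), m.
- by move=> n n1 n2 [m <- <-] [m' /eqP' -> <-].
- move=> a n1 n2 n1' n2' [m <- <-] [m' <- <-]; exists (iota a *: m + m').
    by rewrite linearP -iotaE.
  by rewrite !linearP -iotaE.
by exists g => m; have [m' /eqP' -> <-] := gP (p m).
Qed.

(** Only injectivity on the left is at stake, and its obstruction Tor_1(Q, S / xS) = (0 :_Q x)
    vanishes. *)
Lemma reduction_short_exact K F Q NK NF NQ (pK : {linear K -> restr eps NK})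
    (pF : {linear F -> restr eps NF}) (pQ : {linear Q -> restr eps NQ})
    (i : {linear K -> F}) (p : {linear F -> Q})
    (i' : {linear NK -> NF}) (p' : {linear NF -> NQ}) :
  reduction pK -> reduction pF -> reduction pQ ->
  (forall k, i' (pK k) = pF (i k)) -> (forall f, p' (pF f) = pQ (p f)) ->
  torsion_free Q -> short_exact i p -> short_exact i' p'.
Proof.
move=> [sK Kx] [sF Fx] [sQ Qx] i'E p'E tfQ [inj_i ip sp]; split.
- apply/inj0P => n; have [k <-] := sK n; rewrite i'E => /Fx[f fE].
  have /ip[k' k'E] : p f = 0.
    by apply: tfQ; rewrite -linearZ -fE; apply: (exact0 _ ip).
  apply/Kx; exists k'; apply: inj_i; by rewrite fE linearZ k'E.
- move=> n; have [f <-] := sF n; rewrite p'E; split=> [/Qx[q qE]|[k' k'E]].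
    have [f' f'q] := sp q.
    have /ip[k kE] : p (f - x *: f') = 0 by rewrite linearB linearZ f'q qE subrr.
    exists (pK k); rewrite i'E kE linearB [X in _ - X](_ : _ = 0) ?subr0 //.
    by apply/Fx; exists f'.
  have [k kk'] := sK k'; rewrite -p'E -k'E -kk' i'E p'E (exact0 _ ip); exact: linear0.
- by move=> n; have [q <-] := sQ n; have [f <-] := sp q; exists (pF f).
Qed.

(** M ⊗_S A = (M / xM) ⊗_R A, as [x] kills [A]. Injectivity comes from the left inverse [k], built
    over R by means of [iota]. *)
Lemma base_change M N (p : {linear M -> restr eps N}) A : reduction p ->
  exists t : {linear tensor M (restr eps A) -> restr eps (tensor N A)},
    [/\ forall m a, t (tens m a) = tens (p m : N) (a : A), injective t & surj t].
Proof.
move=> [sp px].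
have [||t tE] := @tensor_univ S M (restr eps A) (restr eps (tensor N A))
  (fun m a => tens (p m : N) (a : A)).
- by move=> a c m m'; rewrite linearP restrZ tensDl tensZl.
- by move=> m c a a'; rewrite restrZ tensDr tensZr.
have hP (a : A) : exists h : {linear N -> restr iota (tensor M (restr eps A))},
    forall m, h (p m) = tens m (a : restr eps A).
  have eqP' m m' : p m = p m' -> tens m (a : restr eps A) = tens m' (a : restr eps A).
    move=> e; have /px[n nE] : p (m - m') = 0 by rewrite linearB e subrr.
    apply/eqP; rewrite -subr_eq0 -[_ - _](linearB (tensl M (a : restr eps A))) nE /=.
    by rewrite tensZl -tensZr restrZ eps_x scale0r tens0r.
  have [||| h hE] := @ex_linear R N (restr iota (tensor M (restr eps A)))
    (fun n u => exists2 m, p m = n & tens m (a : restr eps A) = u).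
  - by move=> n; have [m mn] := sp n; exists (tens m (a : restr eps A)), m.
  - by move=> n u u' [m <- <-] [m' /eqP' -> <-].
  - move=> c n n' u u' [m <- <-] [m' <- <-]; exists (iota c *: m + m').
      by rewrite linearP -iotaE.
    by rewrite tensDl tensZl.
  by exists h => m; have [m' /eqP' -> <-] := hE (p m).
have [h hE] := choice hP.
have [||k kE] := @tensor_univ R N A (restr iota (tensor M (restr eps A))) (fun n a => h a n).
- by move=> a c n n'; rewrite linearP.
- move=> n c a a'; have [m <-] := sp n; rewrite !hE restrZ.
  by rewrite [c *: a]iotaE tensDr tensZr.
exists t; split=> //.
  apply/inj0P => u tu; have <- : k (t u) = u.
    elim/tensor_ind: u {tu} => [|m a u ih]; first by rewrite !linear0.
    by rewrite !linearD ih tE kE hE.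
  by rewrite tu linear0.
elim/tensor_ind => [|n a u [v <-]]; first by exists 0; rewrite linear0.
have [m <-] := sp n; exists (tens m (a : restr eps A) + v).
by rewrite linearD tE.
Qed.

Lemma flat_reduction F N (p : {linear F -> restr eps N}) :
  reduction p -> flat F -> flat N.
Proof.
move=> px flatF; apply: flatP => A B f inj_f.
have [g gE] := ex_tensor_mapr N f.
have [g' g'E] := ex_tensor_mapr F (restr_map eps f).
have inj_g' : injective g'.
  by apply/(tensor_map_swap_inj g'E)/flat_inj.
apply/(tensor_map_swap_inj gE)/inj0P => t.
have [tA [tAE inj_tA stA]] := base_change A px.
have [tB [tBE inj_tB stB]] := base_change B px.
have [u <-] := stA t => gu.
rewrite (_ : u = 0) ?linear0 //; apply: inj_g'; apply: inj_tB; rewrite !linear0 -[RHS]gu.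
elim/tensor_ind: u {gu} => [|m a u ih]; first by rewrite !linear0.
by rewrite !linearD ih g'E tAE tBE gE.
Qed.

Lemma flat_torsion_free F : flat F -> torsion_free F.
Proof.
move=> flatF m xm; have inj_x : injective (scalel S^o x).
  by apply/inj0P => a /x_reg.
have t0 : tens (1 : S^o) m = 0.
  apply: (flat_inj0 flatF inj_x); rewrite tensor_mapE /=.
  by rewrite tensZl -tensZr xm tens0r.
have [||k kE] := @tensor_univ S S^o F F (fun a m => a *: m).
- by move=> n a b c; rewrite scalerDl -scalerA.
- by move=> n a b c; rewrite scalerDr !scalerA mulrC.
by have := kE 1 m; rewrite t0 linear0 scale1r.
Qed.

Lemma torsion_free_sub K F (i : {linear K -> F}) :
  injective i -> torsion_free F -> torsion_free K.
Proof.
by move=> inj_i tfF k xk; apply: inj_i; rewrite linear0; apply: tfF; rewrite -linearZ xk linear0.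
Qed.

(** A flat cover of the x-torsion-free [Q] reduces to a flat cover of [N], and by [base_change]
    Tor_1^S(Q, A) and Tor_1^R(N, A) are kernels of the same map. *)
Lemma tor0_reduction Q N (p : {linear Q -> restr eps N}) A :
  reduction p -> torsion_free Q -> tor0 N A -> tor0 Q (restr eps A).
Proof.
move=> pN tfQ NA K F i q flatF iq; apply/inj0P => t it.
have [NK [pK pKx]] := ex_reduction K; have [NF [pF pFx]] := ex_reduction F.
have [i' i'E] := ex_reduction_map i pKx pFx.
have [q' q'E] := ex_reduction_map q pFx pN.
have iq' := reduction_short_exact pKx pFx pN i'E q'E tfQ iq.
have inj_i' := NA _ _ _ _ (flat_reduction pFx flatF) iq'.
have [tK [tKE inj_tK _]] := base_change A pKx.
have [tF [tFE _ _]] := base_change A pFx.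
apply: inj_tK; rewrite linear0; apply: inj_i'; rewrite [RHS]linear0.
have <- : tF (tensor_map _ i t) = tensor_map A i' (tK t).
  elim/tensor_ind: t {it} => [|m a u ih]; first by rewrite !linear0.
  by rewrite !linearD /= ih tKE !tensor_mapE tFE i'E.
by have -> : tensor_map _ i t = 0 by []; rewrite linear0.
Qed.

Lemma fdle_reduction n K N (p : {linear K -> restr eps N}) :
  reduction p -> torsion_free K -> fdle n K -> fdle n N.
Proof.
elim: n K N p => [|n ih] K N p pN tfK.
  by move=> /fdle0 flatK; apply/fdle0/(flat_reduction pN).
have [F [L [i [q [flatF iq]]]]] := ex_flat_cover K.
have [NL [pL pLx]] := ex_reduction L; have [NF [pF pFx]] := ex_reduction F.
have [i' i'E] := ex_reduction_map i pLx pFx.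
have [q' q'E] := ex_reduction_map q pFx pN.
have iq' := reduction_short_exact pLx pFx pN i'E q'E tfK iq.
rewrite -(fdleS n flatF iq) -(fdleS n (flat_reduction pFx flatF) iq').
apply: (ih _ _ _ pLx); case: iq => inj_i _ _.
exact: (torsion_free_sub inj_i (flat_torsion_free flatF)).
Qed.

Lemma injective_divisible E : injective_module E -> forall e : E, exists e', x *: e' = e.
Proof.
move=> injE e; have inj_x : injective (scalel S^o x) by apply/inj0P => a /x_reg.
have [g gE] := injE _ _ _ (eltl e) inj_x.
exists (g 1); rewrite -linearZ; have := gE 1.
by rewrite /scalel /eltl /= scale1r.
Qed.

(* With 0 -> K -> F -> E -> 0, F flat and E = x E, reduction modulo x gives
   0 -> (0 :_E x) -> K / x K -> F / x F -> 0. *)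
Lemma fdle_torsion n E A (k : {linear restr eps A -> E}) :
  (forall e : E, exists e', x *: e' = e) -> torsion k -> fdle n.+1 E -> fdle n A.
Proof.
move=> divE [inj_k kx].
have [F [K [i [p [flatF ip]]]]] := ex_flat_cover E.
rewrite -(fdleS n flatF ip) => fdK.
have tfF := flat_torsion_free flatF; case: ip => inj_i ip sp.
have [NK [pK [sK Kx]]] := ex_reduction K; have [NF [pF [sF Fx]]] := ex_reduction F.
have [i' i'E] : exists g : {linear NK -> NF}, forall m, g (pK m) = pF (i m).
  exact: ex_reduction_map.
(* The connecting map of the snake lemma for multiplication by [x]: [k a] is lifted to [f], and
   [x *: f] comes from [K]. *)
have [||| d dE] := @ex_linear R A NK (fun a n => exists f k', [/\ p f = k a, i k' = x *: f & pK k' = n]).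
- move=> a; have [f fE] := sp (k a).
  have /ip[k' k'E] : p (x *: f) = 0 by rewrite linearZ fE; apply/kx; exists a.
  by exists (pK k'), f, k'.
- move=> a u u' [f [l [fE lE <-]]] [f' [l' [f'E l'E <-]]].
  have /ip[m mE] : p (f - f') = 0 by rewrite linearB fE f'E subrr.
  apply/eqP; rewrite -subr_eq0 -linearB; apply/eqP/Kx; exists m.
  by apply: inj_i; rewrite linearB linearZ /= mE lE l'E scalerBr.
- move=> c a a' u u' [f [l [fE lE <-]]] [f' [l' [f'E l'E <-]]].
  exists (iota c *: f + f'), (iota c *: l + l'); split.
  + by rewrite linearP fE f'E [c *: a]iotaE linearP.
  + by rewrite linearP lE l'E scalerDr !scalerA mulrC.
  + by rewrite linearP -iotaE.
have di' : short_exact d i'.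
  split.
  - apply/inj0P => a da; have [f [l [fE lE]]] := dE a; rewrite da => /Kx[l' l'E].
    apply: inj_k; rewrite linear0 -fE (_ : f = i l') ?(exact0 _ ip) //.
    apply/eqP; rewrite -subr_eq0; apply/eqP/tfF.
    by rewrite scalerBr -lE l'E linearZ subrr.
  - move=> u; have [l <-] := sK u; rewrite i'E; split=> [/Fx[f fE]|[a aE]].
      have /kx[a aE] : x *: p f = 0 by rewrite -linearZ -fE (exact0 _ ip).
      exists a; have [f' [l' [f'E l'E <-]]] := dE a.
      have /ip[m mE] : p (f' - f) = 0 by rewrite linearB f'E aE subrr.
      apply/eqP; rewrite -subr_eq0 -linearB; apply/eqP/Kx; exists m.
      by apply: inj_i; rewrite linearB linearZ /= mE l'E fE scalerBr.
    have [f [l' [fE l'E l'l]]] := dE a.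
    rewrite -i'E -aE -l'l i'E l'E; by apply/Fx; exists f.
  - move=> u; have [f <-] := sF u; have [e eE] := divE (p f); have [f' f'e] := sp e.
    have /ip[l lE] : p (f - x *: f') = 0 by rewrite linearB linearZ /= f'e eE subrr.
    exists (pK l); rewrite i'E lE linearB [X in _ - X](_ : _ = 0) ?subr0 //.
    by apply/Fx; exists f'.
move=> W Z WZ; apply: (tor0_subflat di'); first exact: (flat_reduction (conj sF Fx)).
apply: (fdle_reduction (conj sK Kx) _ fdK WZ).
exact: (torsion_free_sub inj_i tfF).
Qed.

(** [x] acts as zero on an R-module, so an S-linear map from it to [E] lands in (0 :_E x);
    extensions found in [E] are extensions to [A]. *)
Lemma torsion_injective E A (k : {linear restr eps A -> E}) :
  torsion k -> injective_module E -> injective_module A.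
Proof.
move=> [inj_k kx] injE X Y i f inj_i.
have [h hE] := injE _ _ (restr_map eps i) (compl k (restr_map eps f)) inj_i.
have [||| g gE] := @ex_linear R Y A (fun y a => k a = h y).
- move=> y; apply/kx; rewrite -linearZ restrZ eps_x scale0r; exact: linear0.
- by move=> y a a' <- /inj_k.
- by move=> c y y' a a' aE a'E; rewrite [c *: a]iotaE [c *: y]iotaE !linearP aE a'E.
by exists g => a; apply: inj_k; rewrite gE -[i a]/(restr_map eps i a) hE.
Qed.

Lemma injective_fdle_descent n : (forall E, injective_module E -> fdle n E) ->
  (0 < n)%N /\ forall I : lmodType R, injective_module I -> fdle n.-1 I.
Proof.
move=> fdE; case: n => [|n] in fdE *.
  (* n = 0 is excluded: an injective S-module containing R = S / xS has x-torsion and so is not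
     flat. *)
  have [E [u [injE inj_u]]] := ex_injective_embedding (restr eps R^o).
  have /fdle0/flat_torsion_free tfE := fdE _ injE.
  have /eqP := oner_neq0 R; case; apply: inj_u; rewrite linear0; apply: tfE.
  rewrite -linearZ restrZ eps_x scale0r; exact: linear0.
split=> // I injI.
(* [x] acts as zero on [I], so the image of [I] in [E] lies in (0 :_E x), where it splits off by
   injectivity over R. *)
have [E [u [injE inj_u]]] := ex_injective_embedding (restr eps I).
have [A [k kx]] := ex_torsion E; have [inj_k kxP] := kx.
have [||| s sE] := @ex_linear R I A (fun y a => k a = u y).
- move=> y; apply/kxP; rewrite -linearZ restrZ eps_x scale0r; exact: linear0.
- by move=> y a a' <- /inj_k.
- by move=> c y y' a a' aE a'E; rewrite [c *: a]iotaE [c *: y]iotaE !linearP aE a'E.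
have inj_s : injective s by move=> y y' e; apply: inj_u; rewrite -!sE e.
have [r rE] := injI _ _ s (idl I) inj_s.
move=> W Z WZ; apply: (tor0_retract rE).
exact: (fdle_torsion (injective_divisible injE) kx (fdE _ injE) WZ).
Qed.

End RegularElement.

(** * Coherence and duality *)

Section Coherence.
Variable R : comNzRingType.
Hypothesis cohR : coherent R.

(** Coherence presents the image ideal by some cover [p], not by [f]. As in Schanuel's lemma, with
    lifts [al] and [be] between the two covers, the kernel of [f] is generated by [al] of the kernel
    of [p] and by the elements [u - al (be u)]. *)
Lemma coherent_ideal_kernel b (f : {linear 'rV[R]_b -> R^o}) :
  exists k (h : {linear 'rV[R]_k -> 'rV[R]_b}), exact_at h f.
Proof.
pose P (y : R^o) := exists u, f u = y.
have P0 : P 0 by exists 0; apply: linear0.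
have PP a y z : P y -> P z -> P (a *: y + z).
  by move=> [u <-] [v <-]; exists (a *: u + v); rewrite linearP.
pose I := submod_of P0 PP.
have inI u : f u \in I by apply/asboolP; exists u.
have lin_f : linear (fun u => Submod (inI u)) by move=> a u v; apply: val_inj; rewrite /= linearP.
pose fI := linear_of lin_f.
have sfI : surj fI.
  by move=> y; have /asboolP[u uy] := valP y; exists u; apply: val_inj.
have fgI : finitely_generated (submod I).
  exists b, (fun i => fI (delta_mx 0 i)) => y; have [u <-] := sfI y.
  exists (u 0); rewrite {1}[u]row_sum_delta linear_sum.
  by apply: eq_bigr => i _; rewrite linearZ.
have [m [n [g [p [gp sp]]]]] := cohR fgI.
have [al alE] := projective_lift p sfI; have [be beE] := projective_lift fI sp.
pose h : {linear 'rV[R]_(m + b) -> 'rV[R]_b} :=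
  ((al \o g) \o lsubmx) \+ (rsubmx \- ((al \o be) \o rsubmx)).
have hE u : h u = al (g (lsubmx u)) + (rsubmx u - al (be (rsubmx u))) by [].
exists (m + b)%N, h => u.
have fE v : f v = \val (fI v) by [].
split=> [fu|[v <-]]; last first.
  rewrite fE hE linearD linearB !alE beE subrr addr0 (exact0 _ gp).
  by [].
have fIu : fI u = 0 by apply: val_inj.
have /gp[w wE] : p (be u) = 0 by rewrite beE.
by exists (row_mx w u); rewrite hE row_mxKl row_mxKr wE addrC subrK.
Qed.

(** Induction on [c]: the kernel of the first coordinate is the image of [h1], and the other
    coordinates are pulled back along [h1]. *)
Lemma coherent_kernel b c (f : {linear 'rV[R]_b -> 'rV[R]_c}) :
  exists k (h : {linear 'rV[R]_k -> 'rV[R]_b}), exact_at h f.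
Proof.
elim: c b f => [|c ih] b f.
  exists b, (idl _) => u; split=> [_|_]; first by exists u.
  by apply/rowP => -[].
have lin_f1 : linear (fun u => f u 0 ord0 : R^o) by move=> a u v; rewrite linearP !mxE.
have [k1 [h1 h1P]] := coherent_ideal_kernel (linear_of lin_f1).
have lin_f2 : linear (fun u => \row_(j < c) f (h1 u) 0 (fintype.lift ord0 j)).
  by move=> a u v; apply/rowP => j; rewrite !mxE !linearP !mxE.
have [k2 [h2 h2P]] := ih _ (linear_of lin_f2).
exists k2, (compl h1 h2) => u; split=> [fu|[v <-]].
  have /h1P[v vE] : f u 0 ord0 = 0 by rewrite fu mxE.
  have /h2P[w wE] : linear_of lin_f2 v = 0 by apply/rowP => j; rewrite !mxE vE fu mxE.
  by exists w; rewrite /= wE.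
apply/rowP => j; rewrite mxE; case: (unliftP ord0 j) => [i|] ->.
  by have := exact0 v h2P; move=> /rowP/(_ i); rewrite !mxE.
exact: (exact0 (h2 v) h1P).
Qed.

End Coherence.

Section TensorRow.
Variable R : comNzRingType.
Implicit Types E Q K : lmodType R.

(** [T] is the isomorphism of R^b ⊗ E with Hom(R^b, E), columns being dual to rows. It turns a map
    of rows into precomposition with its matrix. *)
Lemma ex_row_tensor b E : exists T : tensor 'rV[R]_b E -> {linear 'cV[R]_b -> E},
  [/\ forall u e v, T (tens u e) v = (u *m v) 0 0 *: e,
      forall t t' v, T (t + t') v = T t v + T t' v,
      forall t, (forall v, T t v = 0) -> t = 0
    & forall phi : {linear 'cV[R]_b -> E}, exists t, forall v, T t v = phi v].
Proof.
have ex_tau (v : 'cV[R]_b) : exists f : {linear tensor 'rV[R]_b E -> E},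
    forall u e, f (tens u e) = (u *m v) 0 0 *: e.
  apply: (@tensor_univ R _ _ _ (fun u e => (u *m v) 0 0 *: e)).
    by move=> e a u u'; rewrite mulmxDl -scalemxAl !mxE scalerDl -scalerA.
  by move=> u a e e'; rewrite scalerDr !scalerA mulrC.
have [tau tauE] := choice ex_tau.
have lin_T t : linear (fun v => tau v t).
  move=> a v v'; elim/tensor_ind: t => [|u e t ih]; first by rewrite !linear0 ?scaler0 ?addr0.
  rewrite [LHS]linearD ih [tau v (_ + _)]linearD [tau v' (_ + _)]linearD scalerDr !tauE.
  by rewrite mulmxDr -scalemxAr !mxE scalerDl -scalerA addrACA.
pose T t := linear_of (lin_T t).
have TE u e v : T (tens u e) v = (u *m v) 0 0 *: e by rewrite /= tauE.
have TD t t' v : T (t + t') v = T t v + T t' v by rewrite /= linearD.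
have mul_delta (u : 'rV[R]_b) i : (u *m delta_mx i 0 : 'M_1) 0 0 = u 0 i.
  by rewrite -colE mxE.
have tE t : t = \sum_i tens (delta_mx 0 i) (T t (delta_mx i 0)).
  elim/tensor_ind: t => [|u e t ih].
    by rewrite big1 // => i _; rewrite /= linear0 tens0r.
  under eq_bigr do rewrite TD tensDr; rewrite big_split /= -ih; congr (_ + _).
  transitivity (tensl 'rV[R]_b e (\sum_i u 0 i *: delta_mx 0 i)).
    by rewrite -row_sum_delta.
  rewrite linear_sum; apply: eq_bigr => i _.
  by rewrite tauE mul_delta tensZr -tensZl.
exists T; split=> // [t Tt|phi].
  by rewrite (tE t) big1 // => i _; rewrite Tt tens0r.
exists (\sum_i tens (delta_mx 0 i) (phi (delta_mx i 0))) => v.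
rewrite /= linear_sum; under eq_bigr => i _ do rewrite /= tauE -rowE mxE -linearZ.
rewrite -linear_sum; congr (phi _); apply/colP => i.
rewrite summxE (bigD1 i) //= big1 ?addr0 => [|j ji].
  by rewrite !mxE !eqxx mulr1.
by rewrite !mxE eq_sym (negbTE ji) mulr0.
Qed.

Lemma row_tensor_exact a b c (D1 : {linear 'rV[R]_b -> 'rV[R]_a})
    (D2 : {linear 'rV[R]_c -> 'rV[R]_b}) E : exact_at D2 D1 ->
  exact_at (tensor_map E D2) (tensor_map E D1) <->
  forall phi : {linear 'cV[R]_b -> E}, (forall v, phi (lin1_mx D1 *m v) = 0) ->
    exists psi : {linear 'cV[R]_c -> E}, forall v, phi v = psi (lin1_mx D2 *m v).
Proof.
move=> D21.
have [Ta [TaE TaD Ta0 Tas]] := ex_row_tensor a E.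
have [Tb [TbE TbD Tb0 Tbs]] := ex_row_tensor b E.
have [Tc [TcE TcD Tc0 Tcs]] := ex_row_tensor c E.
have Tz n (T : tensor 'rV[R]_n E -> {linear 'cV[R]_n -> E}) :
    (forall u e v, T (tens u e) v = (u *m v) 0 0 *: e) -> forall v, T 0 v = 0.
  by move=> TE v; rewrite -(tens0r E (0 : 'rV[R]_n)) TE scaler0.
have D1T t v : Ta (tensor_map E D1 t) v = Tb t (lin1_mx D1 *m v).
  elim/tensor_ind: t => [|u e t ih]; first by rewrite linear0 (Tz _ _ TaE) (Tz _ _ TbE).
  by rewrite linearD /= TaD TbD ih tensor_mapE TaE TbE mulmxA mul_rV_lin1.
have D2T t v : Tb (tensor_map E D2 t) v = Tc t (lin1_mx D2 *m v).
  elim/tensor_ind: t => [|u e t ih]; first by rewrite linear0 (Tz _ _ TbE) (Tz _ _ TcE).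
  by rewrite linearD /= TbD TcD ih tensor_mapE TbE TcE mulmxA mul_rV_lin1.
split=> [ex phi phi1|dual t].
  have [t tE] := Tbs phi.
  have /ex[s sE] : tensor_map E D1 t = 0.
    by apply: Ta0 => v; rewrite D1T tE.
  by exists (Tc s) => v; rewrite -tE -sE D2T.
split=> [tz|[s <-]]; last first.
  elim/tensor_ind: s => [|u e s ih]; first by rewrite !linear0.
  by rewrite !linearD /= ih !tensor_mapE (exact0 _ D21) tens0l addr0.
have [v|psi psiE] := dual (Tb t).
  by rewrite -D1T; have -> : tensor_map E D1 t = 0 := tz; apply: Tz TaE v.
have [s sE] := Tcs psi; exists s.
apply/eqP; rewrite -subr_eq0; apply/eqP/Tb0 => v.
by apply: (addIr (Tb t v)); rewrite add0r -TbD subrK D2T sE psiE.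
Qed.

(** Tor_1(Q, E) is the homology of R^c ⊗ E -> R^b ⊗ E -> R^a ⊗ E; the condition on [phi] and [psi]
    is its vanishing, rewritten by [row_tensor_exact]. *)
Lemma tor0_presentation Q a b c (D0 : {linear 'rV[R]_a -> Q})
    (D1 : {linear 'rV[R]_b -> 'rV[R]_a}) (D2 : {linear 'rV[R]_c -> 'rV[R]_b}) E :
  surj D0 -> exact_at D1 D0 -> exact_at D2 D1 ->
  tor0 Q E <-> forall phi : {linear 'cV[R]_b -> E}, (forall v, phi (lin1_mx D1 *m v) = 0) ->
    exists psi : {linear 'cV[R]_c -> E}, forall v, phi v = psi (lin1_mx D2 *m v).
Proof.
move=> s0 D10 D21; rewrite -row_tensor_exact //.
have [K [p [i [sp inj_i ip]]]] := ex_image D1.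
have iD0 : short_exact i D0.
  split=> // y; rewrite D10; split=> [[x <-]|[x <-]]; first by exists (p x).
  by have [z <-] := sp x; exists z.
have D2p : exact_at D2 p.
  move=> y; rewrite -D21 -ip; split=> [->|e]; first by rewrite linear0.
  by apply: inj_i; rewrite e linear0.
have rex := tensor_right_exact (N := E) D2p sp.
split=> [QE|ex].
  have inj_iE := QE _ _ _ _ (@flat_rV R a) iD0.
  move=> t; rewrite -(tensor_map_comp ip) -rex; split=> [e|->]; last exact: linear0.
  by apply: inj_iE; rewrite [RHS]linear0.
apply: (tor0_cover (@flat_rV R a) iD0); apply/inj0P => t.
have [u <-] := tensor_map_surj (N := E) sp t.
by rewrite [X in X = 0 -> _](tensor_map_comp ip) => /ex/rex.
Qed.

End TensorRow.

Section Nakayama.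
Variables (S R : comNzRingType) (eps : {rmorphism S -> R}) (x : S).
Hypotheses (eps_x : eps x = 0) (eps_unit : forall a, eps a = 1 -> exists b, a * b = 1).

(* x lies in the Jacobson radical, so \det (1 - x V) is invertible. *)
Lemma nakayama a b k (C : 'M[S]_(b, k)) (M1 : 'M[S]_(b, a)) W V :
  C = M1 *m W + x *: (C *m V) -> exists W', C = M1 *m W'.
Proof.
move=> CE; pose U : 'M[S]_k := 1%:M - x *: V.
have CU : C *m U = M1 *m W.
  by rewrite mulmxBr mulmx1 -scalemxAr {1}CE addrK.
have [d dE] : exists d, \det U * d = 1.
  apply: eps_unit; rewrite -det_map_mx map_mxD map_mx1 map_mxN map_mxZ eps_x.
  by rewrite scale0r subr0 det1.
exists (d *: (W *m \adj U)).
by rewrite -scalemxAr mulmxA -CU -mulmxA mul_mx_adj mul_mx_scalar scalerA mulrC dE scale1r.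
Qed.

End Nakayama.

(** * Ascent from R to S *)

Section Ascent.
Variables (S R : comNzRingType) (eps : {rmorphism S -> R}) (iota : {rmorphism R -> S}).
Variable x : S.
Hypotheses (iotaK : forall r, eps (iota r) = r) (eps_x : eps x = 0).
Hypothesis eps_ker : forall a, eps a = 0 -> exists b, a = x * b.
Hypothesis x_reg : forall a, x * a = 0 -> a = 0.
Hypothesis eps_unit : forall a, eps a = 1 -> exists b, a * b = 1.
Hypothesis cohS : coherent S.

Implicit Types (A B N : lmodType R) (M E F K P Q Z : lmodType S).

Lemma col_lift n M E (q : {linear M -> E}) (f : {linear 'cV[S]_n -> E}) :
  surj q -> exists h : {linear 'cV[S]_n -> M}, forall v, q (h v) = f v.
Proof.
move=> sq; have lin_f : linear (fun u : 'rV[S]_n => f u^T).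
  by move=> a u v; rewrite -linearP -linearP.
have [h hE] := projective_lift (linear_of lin_f) sq.
have lin_h : linear (fun v : 'cV[S]_n => h v^T).
  by move=> a u v; rewrite -linearP -linearP.
by exists (linear_of lin_h) => v; rewrite /= hE /= trmxK.
Qed.

Fact mulmx_lin m n p (M : 'M[S]_(m, n)) : linear (fun v : 'M[S]_(n, p) => M *m v).
Proof. by move=> a u v; rewrite mulmxDr -scalemxAr. Qed.
Definition mulcol m n (M : 'M[S]_(m, n)) : {linear 'cV[S]_n -> 'cV[S]_m} :=
  linear_of (@mulmx_lin m n 1 M).

Lemma coherent_kernel_col b c (M : 'M[S]_(c, b)) :
  exists k (C : 'M[S]_(b, k)), forall v : 'cV[S]_b, M *m v = 0 <-> exists w : 'cV[S]_k, C *m w = v.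
Proof.
have lin_f : linear (fun u : 'rV[S]_b => u *m M^T).
  by move=> a u v; rewrite mulmxDl -scalemxAl.
have [k [h hP]] := coherent_kernel cohS (linear_of lin_f).
exists k, (lin1_mx h)^T => v; split=> [Mv|[w <-]].
  have /hP[w wE] : linear_of lin_f v^T = 0 by rewrite /= -trmx_mul Mv trmx0.
  by exists w^T; rewrite -trmx_mul mul_rV_lin1 wE trmxK.
apply: trmx_inj; have := exact0 w^T hP.
by rewrite /= !trmx_mul trmxK mul_rV_lin1 trmx0.
Qed.

Section Presentation.
Variables (Q : lmodType S) (N : lmodType R) (q : {linear Q -> restr eps N}).
Variables (a b c : nat) (D0 : {linear 'rV[S]_a -> Q}).
Variables (D1 : {linear 'rV[S]_b -> 'rV[S]_a}) (D2 : {linear 'rV[S]_c -> 'rV[S]_b}).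
Hypotheses (s0 : surj D0) (D10 : exact_at D1 D0) (D21 : exact_at D2 D1).
Hypotheses (qN : reduction x q) (tfQ : torsion_free x Q).
Hypothesis torN : forall A, injective_module A -> tor0 N A.

(** Acting on columns, [M1] and [M2] are the duals of [D1] and [D2], so Ext^1(Q, S) is the kernel of
    [M2] modulo the image of [M1]. *)
Let M1 : 'M[S]_(b, a) := lin1_mx D1.
Let M2 : 'M[S]_(c, b) := lin1_mx D2.

Lemma presentation_mul0 : M2 *m M1 = 0.
Proof.
apply/row_matrixP => i; rewrite row_mul row0 /M1 mul_rV_lin1.
by rewrite rowE /M2 mul_rV_lin1 (exact0 _ D21).
Qed.

(** Divisibility of [E] gives psi = x psi1. Then phi - psi1 M2 is a cycle with values in (0 :_E x),
    hence a boundary because Tor_1(Q, (0 :_E x)) = 0. *)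
Lemma tor_scale_injective E (phi : {linear 'cV[S]_b -> E}) (psi : {linear 'cV[S]_c -> E}) :
  injective_module E -> (forall v, phi (M1 *m v) = 0) ->
  (forall v, x *: phi v = psi (M2 *m v)) ->
  exists psi' : {linear 'cV[S]_c -> E}, forall v, phi v = psi' (M2 *m v).
Proof.
move=> injE phi1 phi2.
have [A [k kx]] := ex_torsion iotaK eps_ker E.
have torA : tor0 Q (restr eps A).
  apply: (tor0_reduction iotaK eps_x eps_ker qN tfQ); apply: torN.
  exact: (torsion_injective iotaK eps_x kx).
have [|psi1 psi1E] := @col_lift c _ _ (scalel E x) psi.
  exact: injective_divisible.
have [inj_k kxP] := kx.
pose phi' : {linear 'cV[S]_b -> E} := phi \- (psi1 \o mulcol M2).
have [v|phiA phiAE] := @factor_mono _ _ _ _ k phi' inj_k.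
  apply/kxP; rewrite /= scalerBr phi2.
  by have := psi1E (M2 *m v); rewrite /= => ->; rewrite subrr.
have [v|psiA psiAE] := (tor0_presentation (restr eps A) s0 D10 D21).1 torA phiA.
  apply: inj_k; rewrite phiAE linear0 /= -/M1 phi1 mulmxA presentation_mul0.
  by rewrite mul0mx linear0 subr0.
exists (psi1 \+ (k \o psiA)) => v /=.
by rewrite -psiAE phiAE /= addrC subrK.
Qed.

(** This is Ext^1(Q, S) = 0. A map [phi] to a cogenerator that kills im M1 + x im C is a cycle such
    that x phi kills ker M2 = im C and so is a boundary. Then [phi] is a boundary too and kills im
    C; hence im C lies in im M1 + x im C, and Nakayama applies. *)
Lemma dual_kernel k (C : 'M[S]_(b, k)) :
  (forall v : 'cV[S]_b, M2 *m v = 0 <-> exists w : 'cV[S]_k, C *m w = v) ->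
  exists W, C = M1 *m W.
Proof.
move=> CP.
have [D [injD cogD]] := ex_injective_cogenerator S.
pose r := addl (mulcol M1) (compl (scalel _ x) (mulcol C)).
have rP y : exists w v : 'cV[S]__, C *m y = M1 *m w + x *: (C *m v).
  have [L [l [rl sl]]] := ex_cokernel r.
  suff /rl[[w v] wv] : l (C *m y) = 0 by exists w, v; rewrite -wv.
  apply: cogD => chi; pose phi := compl chi l.
  have phir z : phi (r z) = 0 by rewrite /phi /= (exact0 _ rl) linear0.
  have phi1 v : phi (M1 *m v) = 0.
    by rewrite -(phir (v, 0)) /r /= mulmx0 scaler0 addr0.
  have xphi (v : 'cV[S]_b) : mulcol M2 v = 0 -> compl phi (scalel _ x) v = 0.
    move=> /CP[w <-]; rewrite -(phir (0, w)); congr (phi _).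
    by rewrite /r /= mulmx0 add0r.
  have [psi psiE] := injective_extend injD xphi.
  have [|psi' psi'E] := tor_scale_injective injD phi1 (psi := psi).
    by move=> v; rewrite -linearZ; have := psiE v.
  have /= -> := psi'E (C *m y).
  by have -> : M2 *m (C *m y) = 0 by [apply/CP; exists y]; rewrite linear0.
have [w wP] := choice (fun j => rP (delta_mx j 0)).
have [v vP] := choice wP.
apply: (@nakayama S R eps x eps_x eps_unit _ _ _ C M1
  (\matrix_(i, j) w j i 0) (\matrix_(i, j) v j i 0)).
apply/matrixP => i j; have /colP/(_ i) := vP j; rewrite -colE mxE => ->; rewrite !mxE.
by congr (_ + _ * _); apply: eq_bigr => l _; rewrite !mxE.
Qed.

Lemma tor0_presentation_injective E : injective_module E -> tor0 Q E.
Proof.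
move=> injE; apply/(tor0_presentation E s0 D10 D21) => phi phi1.
have [k [C CP]] := coherent_kernel_col M2.
have [W WE] := dual_kernel CP.
have [v|psi psiE] := @injective_extend _ _ _ _ (mulcol M2) phi injE; last by exists psi => v; rewrite -psiE.
by move=> /CP[w <-]; rewrite WE -mulmxA; apply: phi1.
Qed.

End Presentation.

(** The invariants that propagate: generators and an embedding in a finite free module let coherence
    continue the resolution, and torsion-freeness lets the next cover reduce exactly. Over R the
    count starts at I / xI, hence [m] there against [m.+1] over S. *)
Lemma ex_syzygy_ideal n (f : {linear 'rV[S]_n -> S^o}) (C : lmodType S)
    (q : {linear S^o -> C}) m :
  exact_at f q -> surj q ->
  exists Z, [/\ syzygy C m.+1 Z, torsion_free x Z,
    exists a (D0 : {linear 'rV[S]_a -> Z}), surj D0,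
    exists a (e : {linear Z -> 'rV[S]_a}), injective e
  & exists W N (p : {linear Z -> restr eps N}), reduction x p /\ syzygy W m N].
Proof.
move=> fq sq; elim: m => [|m [Z [CZ tfZ [a [D0 s0]] [a' [e inj_e]] [W [N [p [pN WN]]]]]]].
  have [I [g [i [sg inj_i ig]]]] := ex_image f.
  have lin_e : linear (fun r : S^o => const_mx r : 'rV[S]_1).
    by move=> r u v; apply/rowP => j; rewrite !mxE.
  have flatS : flat (S^o : lmodType S).
    have lin_r : linear (fun u : 'rV[S]_1 => u 0 0 : S^o) by move=> r u v; rewrite !mxE.
    apply: (@flat_retract _ _ _ (linear_of lin_e) (linear_of lin_r)); last exact: flat_rV.
    by move=> y /=; rewrite mxE.
  have iq : short_exact i q.
    split=> // y; rewrite fq; split=> [[u <-]|[u <-]]; first by exists (g u).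
    by have [u' <-] := sg u; exists u'.
  have [N [p pN]] := ex_reduction iotaK eps_ker I.
  exists I; split.
  - exact: (syzygyS (syzygy0 C) flatS iq).
  - by apply: (torsion_free_sub inj_i) => r; apply: x_reg.
  - by exists n, g.
  - exists 1%N, (compl (linear_of lin_e) i) => u v /= uv; apply: inj_i.
    by move/rowP/(_ 0): uv; rewrite !mxE.
  - by exists N, N, p; split=> //; apply: syzygy0.
have [b [h hP]] := coherent_kernel cohS (compl e D0).
have hD0 : exact_at h D0.
  move=> u; rewrite -hP /=; split=> [->|eu]; first by rewrite linear0.
  by apply: inj_e; rewrite eu linear0.
have [K [g [i [sg inj_i ig]]]] := ex_image h.
have iD0 : short_exact i D0.
  split=> // y; rewrite hD0; split=> [[u <-]|[u <-]]; first by exists (g u).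
  by have [u' <-] := sg u; exists u'.
have flatF : flat ('rV[S]_a : lmodType S) := @flat_rV S a.
have [NK [pK pKx]] := ex_reduction iotaK eps_ker K.
have [NF [pF pFx]] := ex_reduction iotaK eps_ker ('rV[S]_a : lmodType S).
have [i' i'E] := ex_reduction_map iotaK i pKx pFx.
have [D0' D0'E] := ex_reduction_map iotaK D0 pFx pN.
have iD0' := reduction_short_exact pKx pFx pN i'E D0'E tfZ iD0.
exists K; split.
- exact: (syzygyS CZ flatF iD0).
- exact: (torsion_free_sub inj_i (flat_torsion_free x_reg flatF)).
- by exists b, g.
- by exists a, i.
- exists W, NK, pK; split=> //.
  exact: (syzygyS WN (flat_reduction iotaK eps_x pFx flatF) iD0').
Qed.

Lemma injective_fdle_ascent m :
  (forall A, injective_module A -> fdle m A) ->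
  forall E, injective_module E -> fdle m.+1 E.
Proof.
move=> fdA E injE; have [J EJ] := ex_syzygy E m.+1.
apply/(fdle_syzygy EJ)/flat_fg_ideals => n f C q fq sq.
have [Z [CZ tfZ [a [D0 s0]] [a' [e inj_e]] [W [N [p [pN WN]]]]]] := ex_syzygy_ideal m fq sq.
(* The syzygies are moved from [E] to the finitely generated side, where they can be resolved by
   finite free modules. *)
apply/(tor0_syzygy CZ EJ).
have [b [D1 D10]] := coherent_kernel cohS (compl e D0).
have {}D10 : exact_at D1 D0.
  move=> u; rewrite -D10 /=; split=> [->|eu]; first by rewrite linear0.
  by apply: inj_e; rewrite eu linear0.
have [c [D2 D21]] := coherent_kernel cohS D1.
apply: (tor0_presentation_injective s0 D10 D21 pN tfZ) => // A injA.
exact: (fdA A injA _ _ WN).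
Qed.

End Ascent.

(** * Power series *)

Section PowerSeriesRing.
Variable R : comNzRingType.
Local Notation S := (powerSeries R).

Definition ps_const (r : R) : S := PowerSeries (fun n => if n is 0%N then r else 0).
Definition ps_x : S := PowerSeries (fun n => (n == 1%N)%:R).
Definition ps_eval0 (a : S) : R := pscoef a 0.

Lemma pscoefM (a b : S) n : pscoef (a * b) n = \sum_(i < n.+1) pscoef a i * pscoef b (n - i).
Proof. by []. Qed.

Lemma pscoefD (a b : S) n : pscoef (a + b) n = pscoef a n + pscoef b n.
Proof. by []. Qed.

Lemma pscoefB (a b : S) n : pscoef (a - b) n = pscoef a n - pscoef b n.
Proof. by []. Qed.

Fact ps_eval0_zmod : zmod_morphism ps_eval0.
Proof. by []. Qed.
Fact ps_eval0_monoid : monoid_morphism ps_eval0.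
Proof. by split=> // a b; rewrite /ps_eval0 pscoefM big_ord1. Qed.
HB.instance Definition _ := GRing.isZmodMorphism.Build S R ps_eval0 ps_eval0_zmod.
HB.instance Definition _ := GRing.isMonoidMorphism.Build S R ps_eval0 ps_eval0_monoid.

Fact ps_const_zmod : zmod_morphism ps_const.
Proof. by move=> a b; apply: powerSeriesP => -[|n] //=; rewrite subr0. Qed.
Fact ps_const_monoid : monoid_morphism ps_const.
Proof.
split=> [|a b]; apply: powerSeriesP => -[|n] //; first by rewrite pscoefM big_ord1.
rewrite pscoefM big_ord_recl big1 ?addr0 /= ?mulr0 // => i _.
by rewrite mul0r.
Qed.
HB.instance Definition _ := GRing.isZmodMorphism.Build R S ps_const ps_const_zmod.
HB.instance Definition _ := GRing.isMonoidMorphism.Build R S ps_const ps_const_monoid.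

Lemma pscoef_xM a n : pscoef (ps_x * a) n = if n is m.+1 then pscoef a m else 0.
Proof.
rewrite pscoefM; case: n => [|n]; first by rewrite big_ord1 mul0r.
rewrite !big_ord_recl big1 ?addr0 /= ?mul0r ?add0r ?mul1r ?subn1 //= => i _.
by rewrite mul0r.
Qed.

Lemma ps_x_reg (a : S) : ps_x * a = 0 -> a = 0.
Proof. by move=> xa; apply: powerSeriesP => n; rewrite -[RHS]/(pscoef (0 : S) n.+1) -xa pscoef_xM. Qed.

Lemma ps_eval0_ker (a : S) : ps_eval0 a = 0 -> exists b, a = ps_x * b.
Proof.
move=> a0; exists (PowerSeries (fun n => pscoef a n.+1)).
by apply: powerSeriesP => -[|n]; rewrite pscoef_xM.
Qed.

Lemma pscoef_expr_x n (b : S) k : (k < n)%N -> pscoef ((ps_x * b) ^+ n) k = 0.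
Proof.
elim: n k => // n ih [|k] kn; rewrite exprS -mulrA pscoef_xM //.
rewrite pscoefM big1 // => i _; rewrite ih ?mulr0 //.
by rewrite (leq_ltn_trans (leq_subr _ _)).
Qed.

(* The inverse of 1 - x b is the x-adic limit of the geometric sums of x b. *)
Lemma ps_eval0_unit (a : S) : ps_eval0 a = 1 -> exists b, a * b = 1.
Proof.
move=> a1; have [b bE] : exists b, 1 - a = ps_x * b.
  by apply: ps_eval0_ker; rewrite rmorphB rmorph1 /= a1 subrr.
pose p n := \sum_(i < n) (ps_x * b) ^+ i.
have pE n k : (k < n)%N -> pscoef (p n) k = pscoef (p k.+1) k.
  elim: n => // n ih; rewrite ltnS leq_eqVlt => /orP[/eqP -> //|kn].
  have -> : p n.+1 = p n + (ps_x * b) ^+ n by rewrite /p big_ord_recr.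
  by rewrite pscoefD (pscoef_expr_x b kn) addr0 ih.
have aE : a = 1 - ps_x * b by rewrite -bE opprB addrC subrK.
exists (PowerSeries (fun n => pscoef (p n.+1) n)); apply: powerSeriesP => n.
(* Coefficient [n] of the product uses only coefficients up to [n], which already agree with those
   of the partial sum [p n.+1]. *)
transitivity (pscoef (a * p n.+1) n).
  by rewrite !pscoefM; apply: eq_bigr => i _; rewrite /= [in RHS]pE // ltnS leq_subr.
rewrite aE -opprB mulNr -subrX1 opprB pscoefB pscoef_expr_x //.
by rewrite subr0.
Qed.

End PowerSeriesRing.

Theorem theorem2p10 (R : comNzRingType) :
  coherent (powerSeries R) -> Gwdim (powerSeries R) = enat_succ (Gwdim R).
Proof.
move=> cohS.
have iotaK (r : R) : ps_eval0 (ps_const r) = r by [].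
have eps_x : ps_eval0 (ps_x R) = 0 by [].
have down n : enat_le (Gwdim (powerSeries R)) (Some n) ->
    (0 < n)%N /\ enat_le (Gwdim R) (Some n.-1).
  move=> /Gwdim_leP/(injective_fdle_descent (x := ps_x R) iotaK eps_x (@ps_eval0_ker R) (@ps_x_reg R)).
  by case=> n0 fdR; split=> //; apply/Gwdim_leP.
have up n : enat_le (Gwdim R) (Some n) -> enat_le (Gwdim (powerSeries R)) (Some n.+1).
  move=> /Gwdim_leP fdR; apply/Gwdim_leP.
  exact: (injective_fdle_ascent iotaK eps_x (@ps_eval0_ker R) (@ps_x_reg R)
    (@ps_eval0_unit R) cohS).
(* The two dimensions are compared through their finite upper bounds; positivity in [down] is what
   makes [n.-1] a true predecessor. *)
case: (Gwdim R) (Gwdim (powerSeries R)) down up => [m|] [s|] //= down up.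
- have := up m (leqnn m); have [s0 ms] := down s (leqnn s).
  by move=> sm; congr Some; apply/eqP; rewrite eqn_leq sm -(prednK s0) ltnS.
- by have := up m (leqnn m).
- by have [] := down s (leqnn s).
Qed.
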